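(* Let $N\ge1$, $0<s<1$, $1<p<\infty$ with $s\,p>N$, and let $u\in \mathcal{W}^{s,p}(\mathbb{R}^N)$ be an extremal for $\mathfrak{m}_{s,p}(\mathbb{R}^N)$. Let $x_0,y_0\in\mathbb{R}^N$ be the (unique) two distinct points such that \[ [u]_{C^{0,\alpha_{s,p}}(\mathbb{R}^N)}=\frac{|u(x_0)-u(y_0)|}{|x_0-y_0|^{\alpha_{s,p}}}. \] Then $u\in L^\infty(\mathbb{R}^N)$ and \[ \min\{u(x_0),u(y_0)\}\le u(x)\le \max\{u(x_0),u(y_0)\},\qquad \mbox{ for every }x\in\mathbb{R}^N. \]
   Context: $[\varphi]_{W^{s,p}(\mathbb{R}^N)}=\left(\iint_{\mathbb{R}^N\times\mathbb{R}^N}\frac{|\varphi(x)-\varphi(y)|^p}{|x-y|^{N+s\,p}}dx\,dy\right)^{1/p}$; $[\varphi]_{C^{0,\alpha}(\mathbb{R}^N)}=\sup_{x\ne y}\frac{|\varphi(x)-\varphi(y)|}{|x-y|^\alpha}$; $\alpha_{s,p}=s-N/p$. $\mathcal{W}^{s,p}(\mathbb{R}^N)$ is the set of continuous functions with finite $[\cdot]_{C^{0,\alpha_{s,p}}(\mathbb{R}^N)}$ and finite $[\cdot]_{W^{s,p}(\mathbb{R}^N)}$. $\mathfrak{m}_{s,p}(\mathbb{R}^N)=\inf\{[\varphi]^p_{W^{s,p}(\mathbb{R}^N)}:\varphi\in C^\infty_0(\mathbb{R}^N),\ [\varphi]_{C^{0,\alpha_{s,p}}(\mathbb{R}^N)}=1\}$.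 An extremal for $\mathfrak{m}_{s,p}(\mathbb{R}^N)$ is a non-constant $u\in\mathcal{W}^{s,p}(\mathbb{R}^N)$ with $[u]^p_{W^{s,p}(\mathbb{R}^N)}=\mathfrak{m}_{s,p}(\mathbb{R}^N)[u]^p_{C^{0,\alpha_{s,p}}(\mathbb{R}^N)}$. *)

(* Defs.v *)
From HB Require Import structures.
From mathcomp Require Import all_boot all_order all_algebra.
From mathcomp Require Import all_classical all_reals all_analysis.
Import Order.TTheory GRing.Theory Num.Theory.
Import numFieldNormedType.Exports.
Local Open Scope classical_set_scope.
Local Open Scope ring_scope.

Definition enorm {R : realType} {N : nat} (x : 'rV[R]_N) : R :=
  Num.sqrt (\sum_(i < N) x ord0 i ^+ 2).

(* Iterated Lebesgue integral over R^n of a function of n real variables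
   (given as the list of the coordinates); for non-negative measurable
   integrands this is the Lebesgue integral on R^n (Tonelli). *)
Fixpoint iint {R : realType} (n : nat) (f : seq R -> \bar R) : \bar R :=
  match n with
  | 0%N => f [::]
  | n.+1 => (\int[@lebesgue_measure R]_(x in setT) iint n (fun l => f (x :: l)))%E
  end.

Definition vec_of {R : realType} (N : nat) (l : seq R) : 'rV[R]_N :=
  \row_(i < N) nth 0 l i.

Definition int_RN_RN {R : realType} {N : nat}
  (F : 'rV[R]_N -> 'rV[R]_N -> \bar R) : \bar R :=
  iint (N + N) (fun l => F (vec_of N (take N l)) (vec_of N (drop N l))).

Definition gagliardo_p {R : realType} (N : nat) (s p : R)
  (phi : 'rV[R]_N -> R) : \bar R :=
  int_RN_RN (fun x y =>
    ((`|phi x - phi y| `^ p) / (enorm (x - y) `^ (N%:R + s * p)))%:E).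

Definition holder_sn {R : realType} {N : nat} (alpha : R)
  (phi : 'rV[R]_N -> R) : \bar R :=
  ereal_sup [set ((`|phi xy.1 - phi xy.2| / (enorm (xy.1 - xy.2) `^ alpha))%:E)
            | xy in [set xy : 'rV[R]_N * 'rV[R]_N | xy.1 != xy.2] ].

Definition alpha_sp {R : realType} (N : nat) (s p : R) : R := s - N%:R / p.

Fixpoint diter {R : realType} {N : nat} (l : seq 'rV[R]_N)
  (f : 'rV[R]_N -> R) : 'rV[R]_N -> R :=
  match l with
  | [::] => f
  | v :: l' => 'D_v (diter l' f)
  end.

Definition smooth {R : realType} {N : nat} (f : 'rV[R]_N -> R) : Prop :=
  forall l : seq 'rV[R]_N, continuous (diter l f) /\
    forall (v x : 'rV[R]_N), derivable (diter l f) x v.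

Definition Cinf0 {R : realType} {N : nat} (f : 'rV[R]_N -> R) : Prop :=
  smooth f /\ compact (closure [set x | f x != 0]).

Definition Wsp {R : realType} (N : nat) (s p : R) (u : 'rV[R]_N -> R) : Prop :=
  continuous u /\ (holder_sn (alpha_sp N s p) u < +oo)%E /\
  (gagliardo_p N s p u < +oo)%E.

Definition m_sp {R : realType} (N : nat) (s p : R) : \bar R :=
  ereal_inf [set gagliardo_p N s p phi | phi in
     [set phi : 'rV[R]_N -> R | Cinf0 phi /\ holder_sn (alpha_sp N s p) phi = 1%E]].

Definition extremal {R : realType} (N : nat) (s p : R) (u : 'rV[R]_N -> R) : Prop :=
  Wsp N s p u /\ (exists x y, u x != u y) /\
  gagliardo_p N s p u = (m_sp N s p * ((fine (holder_sn (alpha_sp N s p) u)) `^ p)%:E)%E.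

(* Main.v *)
(** Let v be the truncation of u between min (u x0, u y0) and max (u x0, u y0).
    It has the same Hoelder quotient at (x0, y0), and |v x - v y| <= |u x - u y|
    everywhere, strictly on an open set of pairs if v differs from u; then
    [v]_W < [u]_W. This contradicts the minimality of u once m_{s,p}, an infimum
    over C^infty_0 only, is known to satisfy
      m_{s,p} (|v x0 - v y0| / |x0 - y0|^alpha)^p <= [v]_W^p.
    For this v is approximated at x0 and y0 by g in C^infty_0 with
    [g]_W^p <= [v]_W^p + e.
    - Cutoff: v is bounded and s p > N, so multiplying by a tent of radius rho
      costs O(rho^(N - s p)).
    - Mollification: on a lattice of mesh h compare the convex combination of
      translates F x = sum_k w_k f (x - h k), whose seminorm is at most that of f
      by Jensen, with the smooth g x = sum_k f (h k) rho (x - h k) / Z. Reindexing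
      the lattice shows |F - g| -> 0 as h -> 0, while g is Lipschitz uniformly in
      h; hence |g x - g y| <= |F x - F y| + min (L |x - y|, e) near the support.
    Both errors are controlled by the integral of
    min (L |x - y|, E)^p / |x - y|^(N + s p) over pairs meeting a ball of radius R,
    which is O(R^N E^p (E/L)^(- s p)) by summing over dyadic shells. *)

(* Finite lattice sums stand in for convolution so that each ingredient stays elementary: smoothness
   becomes stability of an explicit algebra under directional derivatives, and the seminorm bound
   uses Jensen for finite convex combinations plus translation invariance. The price is that the two
   forms of a convolution, averaged translates of f and translated bumps weighted by values of f,
   which agree in the continuum, become two functions: the first has controlled energy, the second
   is smooth. The uniform Lipschitz constant L allows passing from one to the other: their distance
   tends to 0 with L fixed, and the error integral then behaves like E^(p - s p), which vanishes
   since s < 1. Control of g at x0 and y0 is enough because the quotient at this pair bounds the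
   Hoelder seminorm of g from below, and m_{s,p} is compared with g divided by that seminorm. Only
   an upper bound on the energy of g is wanted, so errors enter through (a + b)^p <= (1 + e) a^p + C
   b^p. *)
Require Import Defs.
From HB Require Import structures.
From mathcomp Require Import all_boot all_order all_algebra.
From mathcomp Require Import all_classical all_reals all_analysis.
From mathcomp Require Import measurable_realfun zify ring lra.
Import Order.TTheory GRing.Theory Num.Theory.
Import numFieldNormedType.Exports.
Local Open Scope classical_set_scope.
Local Open Scope ring_scope.
Set Implicit Arguments.
Unset Strict Implicit.

(** * Iterated integrals *)

(* Joint measurability of a function of n real variables, tested on all
   measurable families of lists: this avoids a sigma-algebra on [seq R] and is
   stable under the Tonelli integral of the last variables. *)
Definition lmeas {R : realType} (n : nat) (f : seq R -> \bar R) : Prop :=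
  forall d (T : measurableType d) (g : T -> seq R),
    (forall t, size (g t) = n) ->
    (forall i, measurable_fun setT (fun t => nth 0 (g t) i)) ->
    measurable_fun setT (fun t => f (g t)).

Section iterated_integral.
Context {R : realType}.
Implicit Types (f g : seq R -> \bar R) (l : seq R).

Lemma iint_ge0 n f : (forall l, 0 <= f l)%E -> (0 <= iint n f)%E.
Proof.
elim: n f => [|n IH] f f0 /=; first exact: f0.
by apply: integral_ge0 => x _; exact: IH.
Qed.

Lemma eq_iint n f g : (forall l, size l = n -> f l = g l) -> iint n f = iint n g.
Proof.
elim: n f g => [|n IH] f g fg /=; first exact: fg.
by apply: eq_integral => x _; apply: IH => l sl; apply: fg => /=; rewrite sl.
Qed.

(** The induction enlarges the test space: the next variable becomes a second factor R, and
    measurability of partial integrals (Tonelli) is applied on [T * measurableTypeR R]. This is why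
    [lmeas] quantifies over all measurable types. *)
Lemma lmeas_iint k n f : (forall l, 0 <= f l)%E -> lmeas (k + n) f ->
  lmeas k (fun l => iint n (fun l' => f (l ++ l'))).
Proof.
elim: n k f => [|n IH] k f f0 mf /=.
  move=> d T g sg mg; rewrite [X in measurable_fun _ X](_ : _ = fun t => f (g t)).
    by apply: mf => // t; rewrite sg addn0.
  by apply/funext => t /=; rewrite cats0.
move=> d T g sg mg.
pose h (z : T * measurableTypeR R) :=
  iint n (fun l' => f (rcons (g z.1) z.2 ++ l')).
have mh : measurable_fun setT h.
  have := IH k.+1 f f0; rewrite addSnnS => /(_ mf).
  move=> /(_ _ (T * measurableTypeR R)%type (fun z => rcons (g z.1) z.2)).
  apply=> [t|i]; first by rewrite size_rcons sg.
  rewrite [X in measurable_fun _ X](_ : _ = fun z : T * measurableTypeR R =>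
    if (i < k)%N then nth 0 (g z.1) i else if i == k then z.2 else 0); last first.
    by apply/funext => z; rewrite nth_rcons sg.
  have [_|_] := boolP (i < k)%N.
    apply: (@measurableT_comp _ _ _ _ _ _ (fun t => nth 0 (g t) i)) => //.
  by have [_|_] := boolP (i == k); [exact: measurable_snd|exact: measurable_cst].
have := measurable_fun_fubini_tonelli_F (m2 := @lebesgue_measure R) h mh.
have h0 z : (0 <= h z)%E by apply: iint_ge0.
move=> /(_ h0).
rewrite [X in measurable_fun _ X -> _](_ : _ =
  (fun t => \int[@lebesgue_measure R]_(x in setT) iint n (fun l' => f (g t ++ x :: l')))%E) //.
apply/funext => t; rewrite /fubini_F /=; apply: eq_integral => x _.
by rewrite /h /=; apply: eq_iint => l _; rewrite cat_rcons.
Qed.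

Lemma lmeas_cons n f x : lmeas n.+1 f -> lmeas n (fun l => f (x :: l)).
Proof.
move=> mf d T g sg mg; apply: (mf _ _ (fun t => x :: g t)) => [t|[|i]] /=.
- by rewrite sg.
- exact: measurable_cst.
- exact: mg.
Qed.

Lemma measurable_iint_cons n f : (forall l, 0 <= f l)%E -> lmeas n.+1 f ->
  measurable_fun setT
    (fun x : measurableTypeR R => iint n (fun l => f (x :: l))).
Proof.
move=> f0 mf.
apply: (@lmeas_iint 1 n f f0 mf _ _ (fun x : measurableTypeR R => [:: x])) => // -[|i] /=.
  exact: measurable_id.
by rewrite nth_nil; exact: measurable_cst.
Qed.

Lemma iint_le n f g : (forall l, 0 <= f l)%E -> (forall l, 0 <= g l)%E ->
  lmeas n f -> lmeas n g ->
  (forall l, size l = n -> f l <= g l)%E -> (iint n f <= iint n g)%E.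
Proof.
elim: n f g => [|n IH] f g f0 g0 mf mg fg /=; first exact: fg.
apply: ge0_le_integral => //.
- by move=> x _; exact: iint_ge0.
- exact: measurable_iint_cons.
- exact: measurable_iint_cons.
move=> x _; apply: IH => //; try exact: lmeas_cons.
by move=> l sl; apply: fg => /=; rewrite sl.
Qed.

Lemma iintD n f g : (forall l, 0 <= f l)%E -> (forall l, 0 <= g l)%E ->
  lmeas n f -> lmeas n g ->
  (iint n (fun l => f l + g l) = iint n f + iint n g)%E.
Proof.
elim: n f g => [|n IH] f g f0 g0 mf mg //=.
rewrite -ge0_integralD//; try by [move=> x _; exact: iint_ge0|exact: measurable_iint_cons].
by apply: eq_integral => x _; apply: IH => //; exact: lmeas_cons.
Qed.

Lemma iintZ n f (c : R) : 0 <= c -> (forall l, 0 <= f l)%E -> lmeas n f ->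
  (iint n (fun l => c%:E * f l) = c%:E * iint n f)%E.
Proof.
move=> c0; elim: n f => [|n IH] f f0 mf //=.
rewrite -ge0_integralZl_EFin//; try by [move=> x _; exact: iint_ge0|exact: measurable_iint_cons].
by apply: eq_integral => x _; apply: IH => //; exact: lmeas_cons.
Qed.

Lemma iint_series n (f : nat -> seq R -> \bar R) :
  (forall j l, 0 <= f j l)%E -> (forall j, lmeas n (f j)) ->
  (iint n (fun l => \sum_(j <oo) f j l) = \sum_(j <oo) iint n (f j))%E.
Proof.
elim: n f => [|n IH] f f0 mf //=.
rewrite -integral_nneseries//; last 2 first.
- by move=> j; exact: measurable_iint_cons.
- by move=> j x _; exact: iint_ge0.
by apply: eq_integral => x _; apply: (IH (fun j l => f j (x :: l))) => // j; exact: lmeas_cons.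
Qed.

(** By uniqueness of Lebesgue measure: its pushforward under a translation agrees with it on
    half-open intervals. *)
Lemma lebesgue_measure_translate (t : R) (A : set (measurableTypeR R)) :
  measurable A ->
  lebesgue_measure ((fun x => x + t) @^-1` A) = lebesgue_measure A.
Proof.
have mt : measurable_fun setT (fun x : measurableTypeR R => (x + t : measurableTypeR R)).
  by apply: measurable_funD => //; exact: measurable_cst.
move=> mA.
have := @lebesgue_measure_unique R
  (pushforward (@lebesgue_measure R) (fun x : measurableTypeR R => (x + t : measurableTypeR R))).
move=> /(_ mt) uniq; apply/esym/uniq => // _ [[a b]] _ <-.
rewrite /pushforward [X in _ = lebesgue_measure X](_ : _ = `]a - t, b - t]%classic); last first.
  by apply/seteqP; split => x /=; rewrite !in_itv /= ltrBlDr lerBrDr.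
rewrite !lebesgue_measure_itv /= !lte_fin ltrD2r.
by case: ifP => // _; rewrite -!EFinB; congr (_%:E); ring.
Qed.

Lemma integral_translate (f : measurableTypeR R -> \bar R) (t : R) : (forall x, 0 <= f x)%E ->
  measurable_fun setT f ->
  (\int[@lebesgue_measure R]_(x in setT) f (x + t)%R =
   \int[@lebesgue_measure R]_(x in setT) f x)%E.
Proof.
move=> f0 mf.
have mt : measurable_fun setT (fun x : measurableTypeR R => (x + t : measurableTypeR R)).
  by apply: measurable_funD => //; exact: measurable_cst.
rewrite -[LHS](@ge0_integral_pushforward _ _ _ _ _ _ mt _ setT f) //.
apply: eq_measure_integral => A mA _; exact: lebesgue_measure_translate.
Qed.

End iterated_integral.

(** As for [lmeas], joint measurability is tested along all families with measurable coordinates, so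
    that substitutions such as [x - t] are immediate. *)
Definition pmeas {R : realType} {N : nat} (F : 'rV[R]_N -> 'rV[R]_N -> \bar R) : Prop :=
  forall d (T : measurableType d) (a b : T -> 'rV[R]_N),
    (forall i, measurable_fun setT (fun t => a t ord0 i)) ->
    (forall i, measurable_fun setT (fun t => b t ord0 i)) ->
    measurable_fun setT (fun t => F (a t) (b t)).

Section iterated_integral_geometry.
Context {R : realType}.
Implicit Types (f g : seq R -> \bar R) (l : seq R).

Lemma iint_cat n m f :
  iint (n + m) f = iint n (fun a => iint m (fun b => f (a ++ b))).
Proof.
elim: n f => [//|n IH] f /=.
by apply: eq_integral => x _; exact: IH.
Qed.

Definition translate_seq (t l : seq R) : seq R := [seq a.1 + a.2 | a <- zip l t].

Lemma nth_translate_seq t l i : size l = size t -> (i < size t)%N ->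
  nth 0 (translate_seq t l) i = nth 0 l i + nth 0 t i.
Proof.
move=> e it; rewrite (nth_map (0, 0)) ?size_zip ?e ?minnn//.
by rewrite nth_zip.
Qed.

Lemma iint_translate n t f : size t = n -> (forall l, 0 <= f l)%E -> lmeas n f ->
  iint n (fun l => f (translate_seq t l)) = iint n f.
Proof.
elim: n t f => [|n IH] [|a t] f //= /eq_add_S st f0 mf.
rewrite -[RHS](@integral_translate _ (fun x => iint n (fun l => f (x :: l))) a); last 2 first.
- by move=> x; exact: iint_ge0.
- exact: measurable_iint_cons.
apply: eq_integral => x _.
by rewrite -(IH t (fun l => f (x + a :: l)))//; exact: lmeas_cons.
Qed.

Lemma iint0 n : iint n (fun=> 0%E : \bar R) = 0%E.
Proof. by elim: n => //= n IH; apply: integral0_eq => x _. Qed.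

(** A ball of the sup norm is a cube, so the iterated integral factors coordinate by coordinate. *)
Lemma iint_ball n (c : seq R) (r : R) : 0 <= r -> size c = n ->
  iint n (fun l => (all2 (fun a b => `|a - b| <= r) c l)%:R%:E) = ((r *+ 2) ^+ n)%:E.
Proof.
move=> r0; elim: n c => [|n IH] [|a c] //= /eq_add_S sc.
transitivity (\int[@lebesgue_measure R]_(x in setT)
   (((r *+ 2) ^+ n)%:E * (\1_(`[a - r, a + r]%classic) x)%:E))%E.
  apply: eq_integral => x _.
  rewrite indicE mem_setE in_itv /= -ler_distlC.
  case: (`|a - x| <= r).
    by rewrite mule1 -(IH _ sc).
  by rewrite mule0; exact: iint0.
rewrite ge0_integralZl_EFin//; last 2 first.
- exact/measurable_EFinP/measurable_indic.
- by rewrite exprn_ge0// mulrn_wge0.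
rewrite integral_indic// setIT /= lebesgue_measure_itv /= lte_fin.
rewrite exprSr.
have [rp|] := ltP (a - r) (a + r).
  by rewrite -EFinB -EFinM; congr (_ * _)%:E; rewrite mulr2n; ring.
move=> rle; have -> : r = 0 by apply/eqP; rewrite eq_le r0 andbT; lra.
by rewrite mul0rn mulr0 mule0.
Qed.

Lemma rV_norm_leP {N : nat} (x : 'rV[R]_N) (r : R) : 0 <= r ->
  reflect (forall i, `|x ord0 i| <= r) (`|x| <= r).
Proof.
move=> r0; apply: (iffP idP) => [xr i|xr].
  apply: le_trans xr; rewrite [leRHS]/Num.Def.normr/= mx_normrE.
  exact: (le_bigmax _ _ (ord0, i)).
rewrite /Num.Def.normr/= mx_normrE (bigmax_le _ r0)//= => -[i j] _ /=.
by rewrite ord1.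
Qed.

Lemma all2_vec_of {N : nat} (a b : seq R) (r : R) : 0 <= r ->
  size a = N -> size b = N ->
  all2 (fun x y => `|x - y| <= r) a b = (`|vec_of N a - vec_of N b| <= r).
Proof.
move=> r0 sa sb; rewrite all2E sa sb eqxx /=.
apply/idP/(rV_norm_leP _ r0) => [/(all_nthP (0,0)) h i|h].
  have := h i; rewrite size_zip sa sb minnn ltn_ord => /(_ isT).
  by rewrite nth_zip ?sa ?sb//= !mxE.
apply/(all_nthP (0,0)) => i; rewrite size_zip sa sb minnn => iN.
have := h (Ordinal iN).
by rewrite nth_zip ?sa ?sb//= !mxE.
Qed.

End iterated_integral_geometry.

(** * Integration over pairs of vectors *)

Section pair_integral.
Context {R : realType} {N : nat}.
Implicit Types (F G : 'rV[R]_N -> 'rV[R]_N -> \bar R).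

Lemma lmeas_pmeas F : pmeas F ->
  lmeas (N + N) (fun l => F (vec_of N (take N l)) (vec_of N (drop N l))).
Proof.
move=> mF d T g sg mg.
apply: (mF _ _ (fun t => vec_of N (take N (g t))) (fun t => vec_of N (drop N (g t)))) => i.
  apply: eq_measurable_fun (mg i) => t _.
  by rewrite mxE nth_take.
apply: eq_measurable_fun (mg (N + i)%N) => t _.
by rewrite mxE nth_drop.
Qed.

Lemma int_pair_ge0 F : (forall x y, 0 <= F x y)%E -> (0 <= int_RN_RN F)%E.
Proof. by move=> F0; exact: iint_ge0. Qed.

Lemma eq_int_pair F G : (forall x y, F x y = G x y) -> int_RN_RN F = int_RN_RN G.
Proof. by move=> FG; apply: eq_iint => l _; rewrite FG. Qed.

Lemma int_pair_le F G : (forall x y, 0 <= F x y)%E -> (forall x y, F x y <= G x y)%E ->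
  pmeas F -> pmeas G -> (int_RN_RN F <= int_RN_RN G)%E.
Proof.
move=> F0 FG mF mG; apply: iint_le => //; try exact: lmeas_pmeas.
by move=> l; exact: le_trans (FG _ _).
Qed.

Lemma int_pairD F G : (forall x y, 0 <= F x y)%E -> (forall x y, 0 <= G x y)%E ->
  pmeas F -> pmeas G ->
  (int_RN_RN (fun x y => F x y + G x y) = int_RN_RN F + int_RN_RN G)%E.
Proof. by move=> F0 G0 mF mG; apply: iintD => //; exact: lmeas_pmeas. Qed.

Lemma int_pairZ F (c : R) : 0 <= c -> (forall x y, 0 <= F x y)%E -> pmeas F ->
  (int_RN_RN (fun x y => c%:E * F x y) = c%:E * int_RN_RN F)%E.
Proof.
by move=> c0 F0 mF; apply: (iintZ c0 (fun l => F0 _ _)); exact: lmeas_pmeas.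
Qed.

Lemma int_pair_series (F : nat -> 'rV[R]_N -> 'rV[R]_N -> \bar R) :
  (forall j x y, 0 <= F j x y)%E -> (forall j, pmeas (F j)) ->
  (int_RN_RN (fun x y => \sum_(j <oo) F j x y) = \sum_(j <oo) int_RN_RN (F j))%E.
Proof.
move=> F0 mF.
apply: (iint_series (f := fun j l => F j (vec_of N (take N l)) (vec_of N (drop N l)))) => //.
by move=> j; exact: lmeas_pmeas.
Qed.

Lemma int_pair_translate F (t : 'rV[R]_N) : (forall x y, 0 <= F x y)%E -> pmeas F ->
  int_RN_RN (fun x y => F (x + t) (y + t)) = int_RN_RN F.
Proof.
(* A common shift of x and y by t is the shift of R^(N+N) by [s ++ s]. *)
move=> F0 mF; pose s := [seq t ord0 i | i <- enum 'I_N].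
have ss : size s = N by rewrite size_map size_enum_ord.
have ss2 : size (s ++ s) = (N + N)%N by rewrite size_cat ss.
have nths (i : 'I_N) : nth 0 s i = t ord0 i.
  by rewrite (nth_map i) ?size_enum_ord// nth_ord_enum.
rewrite /int_RN_RN -[RHS](iint_translate ss2)//; last exact: lmeas_pmeas.
apply: eq_iint => l sl.
congr F; apply/rowP => i; rewrite !mxE.
  rewrite !nth_take// nth_translate_seq ?sl// ?ss2 ?ltn_addr//.
  by rewrite nth_cat ss ltn_ord nths.
rewrite !nth_drop nth_translate_seq ?sl// ?ss2 ?ltn_add2l//.
by rewrite nth_cat ss ltnNge leq_addr /= addKn nths.
Qed.

End pair_integral.

(** * Comparison of the Euclidean norm with the sup norm *)

Section euclidean_norm.
Context {R : realType} {N : nat}.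
Implicit Types x y : 'rV[R]_N.

Lemma enorm_ge0 x : 0 <= enorm x.
Proof. exact: sqrtr_ge0. Qed.

Lemma norm_le_enorm x : `|x| <= enorm x.
Proof.
apply/rV_norm_leP; first exact: enorm_ge0.
move=> i; rewrite -sqrtr_sqr; apply: ler_wsqrtr.
rewrite (bigD1 i)//= lerDl; apply: sumr_ge0 => j _; exact: sqr_ge0.
Qed.

Lemma enorm_gt0 x : x != 0 -> 0 < enorm x.
Proof. by move=> x0; apply: lt_le_trans (norm_le_enorm x); rewrite normr_gt0. Qed.

Lemma enorm0 : enorm (0 : 'rV[R]_N) = 0.
Proof. by rewrite /enorm big1 ?sqrtr0// => i _; rewrite mxE expr0n. Qed.

Lemma enorm_le_norm x : enorm x <= N%:R * `|x|.
Proof.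
have h : \sum_(i < N) x ord0 i ^+ 2 <= (N%:R * `|x|) ^+ 2.
  rewrite exprMn.
  apply: (@le_trans _ _ (\sum_(i < N) `|x| ^+ 2)).
    apply: ler_sum => i _; rewrite -real_normK ?num_real//.
    rewrite lerXn2r ?nnegrE//; apply/rV_norm_leP => //.
  rewrite sumr_const card_ord -[leLHS]mulr_natl; apply: ler_wpM2r; first exact: sqr_ge0.
  by rewrite -natrX ler_nat; case: (N) => // n; rewrite leq_pmulr.
by rewrite /enorm (le_trans (ler_wsqrtr h))// sqrtr_sqr ger0_norm// mulr_ge0.
Qed.

End euclidean_norm.

Section pair_measurability.
Context {R : realType} {N : nat}.

(** The open set {u > r} is the countable union of the cubes with rational centre and radius 1/(n+1)
    that it contains, and the preimage of a cube is a finite intersection of conditions on single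
    coordinates. *)
Lemma measurable_comp_rV d (T : measurableType d) (a : T -> 'rV[R]_N) (u : 'rV[R]_N -> R) :
  continuous u -> (forall i, measurable_fun setT (fun t => a t ord0 i)) ->
  measurable_fun setT (fun t => u (a t)).
Proof.
move=> cu ma.
apply: (measurability _ (RGenOInfty.measurableE R)) => _ [_ [r ->]] <-.
rewrite setTI.
pose box (z : 'rV[rat]_N * nat) :=
  [set x : 'rV[R]_N | forall i, `|x ord0 i - ratr (z.1 ord0 i)| < z.2.+1%:R^-1].
pose P (z : 'rV[rat]_N * nat) := box z `<=` [set x | r < u x].
rewrite [X in measurable X](_ : _ =
    \bigcup_(z : 'rV[rat]_N * nat) if `[< P z >] then (a @^-1` box z) else set0).
  apply: countable_bigcupT_measurable => // z.
  case: ifPn => // _.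
  rewrite [X in measurable X](_ : _ = \bigcap_(i : 'I_N)
      [set t | `|a t ord0 i - ratr (z.1 ord0 i)| < z.2.+1%:R^-1]); last first.
    apply/seteqP; split => t /= h i; first by move=> _; exact: h.
    by exact: h i Logic.I.
  apply: fin_bigcap_measurable; first exact: finite_finset.
  move=> i _.
  have : measurable_fun setT (fun t => `|a t ord0 i - ratr (z.1 ord0 i)| < z.2.+1%:R^-1).
    apply: measurable_fun_ltr; last exact: measurable_cst.
    apply: measurableT_comp => //; apply: measurable_funB => //.
  by move=> /(_ measurableT [set true]); rewrite setTI; apply.
apply/seteqP; split => [t /=|t [z _]]; last first.
  by case: ifPn => [/asboolP Pz bt|//]; rewrite /= in_itv /= andbT; exact: Pz.
rewrite in_itv /= andbT => rt.
have /cvgrPdist_lt /(_ (u (a t) - r)) := cu (a t).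
rewrite subr_gt0 => /(_ rt) /nbhs_ballP[e /= e0 he].
(* A cube of radius 1/(k+1) whose centre is that close to [a t] has all its points within 2/(k+1) <
   e of [a t]. *)
pose k := Num.truncn (2 / e).
have ke : 2 * k.+1%:R^-1 < e.
  by rewrite ltr_pdivrMr// mulrC -ltr_pdivrMr// truncnS_gt.
have kp : (0 : R) < k.+1%:R^-1 by rewrite invr_gt0.
have q i : {q : rat | `|a t ord0 i - ratr q| < k.+1%:R^-1}.
  have /rat_in_itvoo h : a t ord0 i - k.+1%:R^-1 < a t ord0 i + k.+1%:R^-1.
    by rewrite ltrBlDr -addrA ltrDl addr_gt0.
  apply: cid; have [q] := h.
  by rewrite in_itv /= -ltr_distlC; exists q.
exists (\row_i sval (q i), k) => //.
rewrite ifT => /= [i|]; first by rewrite mxE; exact: (svalP (q i)).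
apply/asboolP => x bx /=.
have : ball (a t) e x.
  rewrite -ball_normE /=; apply: le_lt_trans ke.
  apply/rV_norm_leP => [|i]; first by rewrite mulr_ge0// ltW.
  rewrite !mxE.
  have := bx i; rewrite /= mxE => /ltW b1.
  have /ltW b2 := svalP (q i).
  rewrite -(subrKA (ratr (sval (q i)))) (le_trans (ler_normD _ _))//.
  by rewrite mulr_natl mulr2n lerD// distrC.
move=> /he /=.
by rewrite ltr_distlC => /andP[]; rewrite subKr.
Qed.

Lemma measurable_comp_enormB d (T : measurableType d) (a b : T -> 'rV[R]_N) :
  (forall i, measurable_fun setT (fun t => a t ord0 i)) ->
  (forall i, measurable_fun setT (fun t => b t ord0 i)) ->
  measurable_fun setT (fun t => enorm (a t - b t)).
Proof.
move=> ma mb.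
rewrite [X in measurable_fun _ X](_ : _ = fun t =>
    (\sum_(i < N) (a t ord0 i - b t ord0 i) ^+ 2) `^ 2^-1); last first.
  apply/funext => t; rewrite powR12_sqrt; last by apply: sumr_ge0 => i _; exact: sqr_ge0.
  by congr Num.sqrt; apply: eq_bigr => i _; rewrite !mxE.
apply: (measurableT_comp (measurable_powR _)).
by apply: measurable_sum => i; apply: measurable_funX; exact: measurable_funB.
Qed.

Lemma measurable_comp_normB d (T : measurableType d) (a b : T -> 'rV[R]_N) :
  (forall i, measurable_fun setT (fun t => a t ord0 i)) ->
  (forall i, measurable_fun setT (fun t => b t ord0 i)) ->
  measurable_fun setT (fun t => `|a t - b t|).
Proof.
move=> ma mb; apply: (measurable_comp_rV (a := fun t => a t - b t) (u := Num.norm)).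
  by move=> x; exact: norm_continuous.
move=> i; apply: eq_measurable_fun (measurable_funB (ma i) (mb i)) => t _.
by rewrite !mxE.
Qed.

Lemma pmeasD (F G : 'rV[R]_N -> 'rV[R]_N -> \bar R) : pmeas F -> pmeas G ->
  pmeas (fun x y => F x y + G x y)%E.
Proof. by move=> mF mG d T a b ma mb; apply: emeasurable_funD; [exact: mF|exact: mG]. Qed.

Lemma pmeasZ (c : R) (F : 'rV[R]_N -> 'rV[R]_N -> \bar R) : pmeas F ->
  pmeas (fun x y => c%:E * F x y)%E.
Proof. by move=> mF d T a b ma mb; apply: measurable_funeM; exact: mF. Qed.

Lemma pmeas_series (F : nat -> 'rV[R]_N -> 'rV[R]_N -> \bar R) :
  (forall j x y, 0 <= F j x y)%E -> (forall j, pmeas (F j)) ->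
  pmeas (fun x y => \sum_(j <oo) F j x y)%E.
Proof.
move=> F0 mF d T a b ma mb.
apply: (ge0_emeasurable_sum (h := fun j t => F j (a t) (b t))) => //.
by move=> j _; exact: mF.
Qed.

Lemma pmeas_gagliardo (p q : R) (u : 'rV[R]_N -> R) : continuous u ->
  pmeas (fun x y => ((`|u x - u y| `^ p) / (enorm (x - y) `^ q))%:E).
Proof.
move=> cu d T a b ma mb; apply/measurable_EFinP.
apply: measurable_funM.
  apply: (measurableT_comp (measurable_powR _)).
  by apply: measurableT_comp => //; apply: measurable_funB; exact: measurable_comp_rV.
under eq_fun do rewrite -powRN.
by apply: (measurableT_comp (measurable_powR _)); exact: measurable_comp_enormB.
Qed.

End pair_measurability.

(** * Volume of neighbourhoods of the diagonal *)

Section ball_indicator.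
Context {R : realType} {N : nat}.
Implicit Types x y : 'rV[R]_N.

Lemma pmeas_bool (B : 'rV[R]_N -> 'rV[R]_N -> bool) :
  (forall d (T : measurableType d) (a b : T -> 'rV[R]_N),
    (forall i, measurable_fun setT (fun t => a t ord0 i)) ->
    (forall i, measurable_fun setT (fun t => b t ord0 i)) ->
    measurable_fun setT (fun t => B (a t) (b t))) ->
  pmeas (fun x y => (B x y)%:R%:E).
Proof.
move=> mB d T a b ma mb; apply/measurable_EFinP.
rewrite [X in measurable_fun _ X](_ : _ = fun t => if B (a t) (b t) then 1 else 0); last first.
  by apply/funext => t; case: (B _ _).
apply: measurable_fun_ifT; first exact: mB.
  exact: measurable_cst.
exact: measurable_cst.
Qed.

(** The affine centre serves two purposes: k = 1, c = 0 gives the strip |x - y| <= r, while k = 0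
    decouples the variables and gives a product of two balls. *)
Lemma pmeas_ball_ball (k : R) (c : 'rV[R]_N) (R0 r : R) :
  pmeas (fun x y => ((`|x| <= R0) && (`|k *: x + c - y| <= r))%:R%:E).
Proof.
apply: pmeas_bool => d T a b ma mb.
apply: measurable_and.
  apply: measurable_fun_ler => //.
  by apply: (measurable_comp_rV (u := Num.norm)) => // x; exact: norm_continuous.
apply: measurable_fun_ler => //.
apply: (measurable_comp_normB (a := fun t => k *: a t + c)) => // i.
apply: eq_measurable_fun (measurable_funD (measurable_funM (measurable_cst k) (ma i))
  (measurable_cst (c ord0 i))) => t _.
by rewrite !mxE.
Qed.

Lemma int_ball_ball (k : R) (c : 'rV[R]_N) (R0 r : R) : 0 <= R0 -> 0 <= r ->
  int_RN_RN (fun x y : 'rV[R]_N => ((`|x| <= R0) && (`|k *: x + c - y| <= r))%:R%:E) =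
  ((R0 *+ 2) ^+ N * (r *+ 2) ^+ N)%:E.
Proof.
move=> R00 r0; rewrite /int_RN_RN iint_cat.
transitivity (iint N (fun a : seq R => ((r *+ 2) ^+ N)%:E *
    (all2 (fun v w => `|v - w| <= R0) (nseq N 0) a)%:R%:E)%E); last first.
  rewrite (@iintZ R).
  - rewrite iint_ball ?size_nseq// -EFinM; congr (_%:E); exact: mulrC.
  - by rewrite exprn_ge0// mulrn_wge0.
  - by move=> l; rewrite lee_fin.
  move=> d T g sg mg.
  (* With k = 0, c = 0, r = 0 and second point 0, the second condition is always true and a single
     ball remains. *)
  have h := @pmeas_ball_ball 0 0 R0 0 d T (fun t => vec_of N (g t)) (fun=> 0).
  apply: eq_measurable_fun (h _ _) => [t _|i|i].
  - rewrite scale0r addr0 subrr normr0 lexx andbT.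
    rewrite (all2_vec_of (N := N)) ?size_nseq//.
    rewrite (_ : vec_of N (nseq N 0) = 0) ?sub0r ?normrN//.
    by apply/rowP => i; rewrite !mxE nth_nseq; case: ifP.
  - by apply: eq_measurable_fun (mg i) => t _; rewrite mxE.
  - exact: measurable_cst.
apply: eq_iint => a sa.
pose ctr := [seq k * nth 0 a i + c ord0 i | i : 'I_N].
have sctr : size ctr = N by rewrite size_map size_enum_ord.
have ctrE : vec_of N ctr = k *: vec_of N a + c.
  by apply/rowP => i; rewrite !mxE (nth_map i) ?size_enum_ord// nth_ord_enum.
transitivity (iint N (fun b : seq R => (`|vec_of N a : 'rV[R]_N| <= R0)%R%:R%:E *
    (all2 (fun v w => `|v - w| <= r) ctr b)%:R%:E)%E).
  apply: eq_iint => b sb; rewrite take_size_cat// drop_size_cat//.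
  rewrite (all2_vec_of (N := N)) //.
  by rewrite ctrE; case: (_ <= _); rewrite /= ?mul0e ?mul1e.
rewrite (@iintZ R); last 3 first.
- exact: ler0n.
- by move=> l; rewrite lee_fin.
- move=> d T g sg mg.
  have h := @pmeas_ball_ball 1 0 r r d T (fun t => vec_of N ctr - vec_of N (g t)) (fun t => vec_of N ctr - vec_of N (g t)).
  have mi i : measurable_fun setT
      (fun t => (vec_of N ctr - vec_of N (g t)) ord0 i).
    apply: eq_measurable_fun (measurable_funB (measurable_cst (vec_of N ctr ord0 i)) (mg i)) => t _.
    by rewrite !mxE.
  apply: eq_measurable_fun (h mi mi) => t _.
  by rewrite scale1r addr0 subrr normr0 r0 andbT (all2_vec_of (N := N))// size_map.
rewrite iint_ball // (all2_vec_of (N := N)) ?size_nseq//.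
have -> : vec_of N (nseq N 0) = 0 :> 'rV[R]_N.
  by apply/rowP => i; rewrite !mxE nth_nseq; case: ifP.
by rewrite sub0r normrN muleC.
Qed.

Definition near_ball (R0 r : R) x y : bool :=
  ((`|x| <= R0) || (`|y| <= R0)) && (`|x - y| <= r).

Lemma pmeas_near_ball (R0 r : R) : pmeas (fun x y => (near_ball R0 r x y)%:R%:E).
Proof.
apply: pmeas_bool => d T a b ma mb.
apply: measurable_and.
  by apply: measurable_or; apply: measurable_fun_ler => //;
    apply: (measurable_comp_rV (u := Num.norm)) => // x; exact: norm_continuous.
by apply: measurable_fun_ler => //; exact: measurable_comp_normB.
Qed.

(* For r <= R0 the point x lies in the ball of radius 2 R0; for r > R0 and
   |y| <= R0 it lies in the ball of radius 2 r. Either way no exchange of the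
   order of integration is needed. *)
Lemma int_near_ball (R0 r : R) : 0 <= R0 -> 0 <= r ->
  (int_RN_RN (fun x y : 'rV[R]_N => (near_ball R0 r x y)%:R%:E)
   <= (2 * (8 * R0 * r) ^+ N)%:E)%E.
Proof.
move=> R00 r0.
have ind0 (b : bool) : (0 <= b%:R%:E :> \bar R)%E by rewrite lee_fin.
have [rR|Rr] := leP r R0.
  apply: (@le_trans _ _ (int_RN_RN (fun x y : 'rV[R]_N =>
      ((`|x| <= R0 *+ 2) && (`|1 *: x + 0 - y| <= r))%:R%:E))).
    apply: int_pair_le => // [x y||].
    - rewrite lee_fin ler_nat /near_ball scale1r addr0.
      case: (leP `|x - y| r) => xyr; last by rewrite andbF.
      rewrite !andbT; case: orP => //= xy; suff -> : `|x| <= R0 *+ 2 by [].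
      case: xy => h; first by rewrite (le_trans h)// mulr2n lerDl.
      by rewrite -(subrK y x) (le_trans (ler_normD _ _))// mulr2n lerD// (le_trans xyr).
    - exact: pmeas_near_ball.
    - exact: pmeas_ball_ball.
  rewrite int_ball_ball ?mulrn_wge0// lee_fin -exprMn.
  rewrite (_ : R0 *+ 2 *+ 2 * (r *+ 2) = 8 * R0 * r); last by ring.
  by rewrite ler_peMl ?ler1n// exprn_ge0// !mulr_ge0.
apply: (@le_trans _ _ (int_RN_RN (fun x y : 'rV[R]_N =>
    ((`|x| <= R0) && (`|1 *: x + 0 - y| <= r))%:R%:E +
    ((`|x| <= r *+ 2) && (`|0 *: x + 0 - y| <= R0))%:R%:E)%E)).
  apply: int_pair_le => // [x y||].
  - rewrite -EFinD lee_fin /near_ball scale1r scale0r !addr0 sub0r normrN -natrD ler_nat.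
    case: (leP `|x - y| r) => xyr; last by rewrite andbF.
    rewrite !andbT; case: (leP `|x| R0) => //= _.
    case: (leP `|y| R0) => //= yR; suff -> : `|x| <= r *+ 2 by [].
    by rewrite -(subrK y x) (le_trans (ler_normD _ _))// mulr2n lerD// (le_trans yR)// ltW.
  - exact: pmeas_near_ball.
  - by apply: pmeasD; exact: pmeas_ball_ball.
rewrite int_pairD//; try exact: pmeas_ball_ball.
rewrite !int_ball_ball ?mulrn_wge0// -EFinD lee_fin -!exprMn.
rewrite (_ : r *+ 2 *+ 2 * (R0 *+ 2) = 8 * R0 * r); last by ring.
rewrite [leRHS]mulr_natl [leRHS]mulr2n lerD2r lerXn2r ?nnegrE ?mulr_ge0 ?mulrn_wge0//.
rewrite (_ : 8 * R0 * r = R0 *+ 2 * (r *+ 2) *+ 2); last by ring.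
by rewrite [leRHS]mulr2n lerDl mulr_ge0 ?mulrn_wge0.
Qed.

End ball_indicator.

(** * Integral of the truncated Lipschitz kernel *)

Section truncated_kernel.
Context {R : realType}.

Lemma geometric_partial_sum_le (a : R) n : 0 <= a -> a < 1 ->
  \sum_(0 <= i < n) a ^+ i <= (1 - a)^-1.
Proof.
move=> a0 a1; have d0 : 0 < 1 - a by rewrite subr_gt0.
rewrite -[leRHS]div1r ler_pdivlMr// mulrC.
suff -> : (1 - a) * \sum_(0 <= i < n) a ^+ i = 1 - a ^+ n.
  by rewrite gerBl exprn_ge0.
elim: n => [|n IH]; first by rewrite big_geq// expr0 subrr mulr0.
by rewrite big_nat_recr//= mulrDr IH exprS; ring.
Qed.

Lemma exists_pow2_ge (x : R) : exists n, x <= 2 ^+ n.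
Proof.
exists (Num.truncn x).+1; apply: le_trans (ltW (truncnS_gt x)) _.
by rewrite -natrX ler_nat ltnW// ltn_expl.
Qed.

(** Take the least n with lam 2^(-n) / 2 < d; at n = 0 the hypothesis d <= lam takes the place of
    minimality. *)
Lemma dyadic_small (lam d : R) : 0 < d -> d <= lam ->
  exists j, d <= lam * 2^-1 ^+ j /\ lam * 2^-1 ^+ j / 2 < d.
Proof.
move=> d0 dl.
have l0 : 0 < lam by exact: lt_le_trans dl.
have ex : exists n, lam * 2^-1 ^+ n / 2 < d.
  have [n hn] := exists_pow2_ge (lam / d).
  exists n; rewrite exprVn -mulrA -invfM ltr_pdivrMr// ?mulr_gt0// ?exprn_gt0//.
  move: hn; rewrite ler_pdivrMr// => /le_lt_trans; apply.
  have -> : d * (2 ^+ n * 2) = 2 * (2 ^+ n * d) by ring.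
  by rewrite ltr_pMl ?mulr_gt0 ?exprn_gt0// ltr1n.
have [n hn nmin] := ex_minnP ex.
exists n; split => //.
case: n hn nmin => [_ _|n _ nmin]; first by rewrite expr0 mulr1.
rewrite leNgt; apply/negP => lt.
have := nmin n; rewrite ltnn; apply/implyP.
by rewrite exprSr mulrA in lt; rewrite lt.
Qed.

Lemma dyadic_large (lam d : R) : 0 < lam -> lam < d ->
  exists j, d <= lam * 2 ^+ j.+1 /\ lam * 2 ^+ j < d.
Proof.
move=> l0 ld.
have ex : exists n, d <= lam * 2 ^+ n.+1.
  have [n hn] := exists_pow2_ge (d / lam).
  exists n; move: hn; rewrite ler_pdivrMr// mulrC => /le_trans; apply.
  by rewrite ler_pM2l// ler_eXn2l ?ltr1n.
have [n hn nmin] := ex_minnP ex.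
exists n; split => //.
case: n hn nmin => [_ _|n _ nmin]; first by rewrite expr0 mulr1.
rewrite ltNge; apply/negP => le.
by have := nmin n; rewrite ltnn; apply/implyP; rewrite le.
Qed.

(** Cost of changing increments by at most [Num.min (L * d) E] on the pairs that meet a ball. The
    numerator uses the sup norm and the denominator the larger Euclidean norm, so bounds in terms of
    the sup distance alone are upper bounds. *)
Definition truncated_kernel {N : nat} (s p R0 L E : R) (x y : 'rV[R]_N) : R :=
  ((`|x| <= R0) || (`|y| <= R0))%:R * Num.min (L * `|x - y|) E `^ p
  / enorm (x - y) `^ (N%:R + s * p).

Lemma truncated_kernel_ge0 {N : nat} (s p R0 L E : R) (x y : 'rV[R]_N) :
  0 <= truncated_kernel s p R0 L E x y.
Proof. by rewrite /truncated_kernel divr_ge0 ?powR_ge0// mulr_ge0 ?powR_ge0. Qed.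

Lemma pmeas_truncated_kernel {N : nat} (s p R0 L E : R) :
  pmeas (fun x y : 'rV[R]_N => (truncated_kernel s p R0 L E x y)%:E).
Proof.
move=> d T a b ma mb; apply/measurable_EFinP.
apply: measurable_funM; last first.
  under eq_fun do rewrite -powRN.
  by apply: (measurableT_comp (measurable_powR _)); exact: measurable_comp_enormB.
apply: measurable_funM.
  have h : measurable_fun setT (fun t => (`|a t| <= R0) || (`|b t| <= R0)).
    by apply: measurable_or; apply: measurable_fun_ler => //;
      apply: (measurable_comp_rV (u := Num.norm)) => // x; exact: norm_continuous.
  rewrite [X in measurable_fun _ X](_ : _ =
    fun t => if (`|a t| <= R0) || (`|b t| <= R0) then 1 else 0); last first.
    by apply/funext => t; case: (_ || _).
  by apply: measurable_fun_ifT => //; exact: measurable_cst.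
apply: (measurableT_comp (measurable_powR _)).
apply: measurable_minr; last exact: measurable_cst.
by apply: measurable_funM; [exact: measurable_cst|exact: measurable_comp_normB].
Qed.

Section dyadic_shells.
Context {N : nat} (s p R0 L E : R).
Hypotheses (s0 : 0 < s) (s1 : s < 1) (p0 : 0 < p) (L0 : 0 < L) (E0 : 0 < E).
(* The distance at which [Num.min (L * d) E] changes branch. *)
Let lam := E / L.
Let q := N%:R + s * p.
(** The shells are rin j / 2 < d <= rin j below [lam] and rout j < d <= rout j.+1 above it; [cin]
    and [cout] bound the kernel there. In [shell] full neighbourhoods replace the shells, an
    overcounting that the geometric series absorb: their ratios are [a] < 1, because s < 1, and [b]
    < 1, because s p > 0. The factor 2^q in [A] comes from halving the inner radius, the 16 in [B]
    from doubling the outer one. *)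
Let rin j := lam * 2^-1 ^+ j.
Let rout j := lam * 2 ^+ j.
Let cin j := (L * rin j) `^ p / (rin j / 2) `^ q.
Let cout j := E `^ p / rout j `^ q.
Let M := R0 ^+ N * E `^ p * lam `^ (- (s * p)).
Let a := 2^-1 `^ (p - s * p).
Let b := 2 `^ (- (s * p)) : R.
Let A := 2 * 8 ^+ N * 2 `^ q : R.
Let B := 2 * 16 ^+ N : R.

Let shell j (x y : 'rV[R]_N) : \bar R :=
  ((cin j)%:E * (near_ball R0 (rin j) x y)%:R%:E +
   (cout j)%:E * (near_ball R0 (rout j.+1) x y)%:R%:E)%E.

Let lam0 : 0 < lam. Proof. exact: divr_gt0. Qed.
Let q0 : 0 < q. Proof. by rewrite ltr_wpDl// mulr_gt0. Qed.
Let rin0 j : 0 < rin j. Proof. by rewrite mulr_gt0// exprn_gt0. Qed.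
Let rout0 j : 0 < rout j. Proof. by rewrite mulr_gt0// exprn_gt0. Qed.
Let cin0 j : 0 <= cin j. Proof. by rewrite divr_ge0 ?powR_ge0. Qed.
Let cout0 j : 0 <= cout j. Proof. by rewrite divr_ge0 ?powR_ge0. Qed.

Let shell0 j x y : (0 <= shell j x y)%E.
Proof. by rewrite adde_ge0// mule_ge0 ?lee_fin. Qed.

Let kernel_le_shells x y :
  ((truncated_kernel s p R0 L E x y)%:E <= \sum_(j <oo) shell j x y)%E.
Proof.
rewrite /truncated_kernel.
have [xyR|] := boolP ((`|x| <= R0) || (`|y| <= R0)); last first.
  by rewrite mul0r mul0r => _; apply: nneseries_ge0.
have [->|xy] := eqVneq x y.
  (* On the diagonal the denominator is 0^q = 0 and its inverse is 0 by convention, so the kernel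
     vanishes. *)
  rewrite subrr enorm0 powR0 ?gt_eqF// invr0 mulr0; exact: nneseries_ge0.
set d := `|x - y|.
have d0 : 0 < d by rewrite normr_gt0 subr_eq0.
have single j : (shell j x y <= \sum_(j <oo) shell j x y)%E.
  rewrite (@nneseriesD1 _ _ j)// leeDl//.
  by apply: nneseries_ge0 => n _ _; exact: shell0.
have de : d <= enorm (x - y) by exact: norm_le_enorm.
have min0 : 0 <= Num.min (L * d) E by rewrite le_min mulr_ge0 ?ltW.
rewrite mul1r.
have [dl|ld] := leP d lam.
  have [j [dj jd]] := dyadic_small d0 dl.
  apply: le_trans (single j); rewrite /shell.
  apply: (@le_trans _ _ (cin j)%:E); last first.
    by rewrite /near_ball xyR /= -/d dj mule1 leeDl// mule_ge0 ?lee_fin.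
  rewrite lee_fin /cin ler_pM ?powR_ge0 ?invr_ge0 ?powR_ge0//.
    apply: (ge0_ler_powR (ltW p0) min0).
      by rewrite nnegrE mulr_ge0 ?ltW.
    by apply: (@le_trans _ _ (L * d)); rewrite ?ge_min ?lexx// ler_pM2l.
  rewrite lef_pV2 ?posrE ?powR_gt0 ?divr_gt0//; last exact: lt_le_trans de.
  apply: ge0_ler_powR; rewrite ?nnegrE ?divr_ge0 ?enorm_ge0 ?ltW//.
  exact: lt_le_trans de.
have [j [dj jd]] := dyadic_large lam0 ld.
apply: le_trans (single j); rewrite /shell.
apply: (@le_trans _ _ (cout j)%:E); last first.
  by rewrite /near_ball xyR /= -/d dj mule1 leeDr// mule_ge0 ?lee_fin.
rewrite lee_fin /cout ler_pM ?powR_ge0 ?invr_ge0 ?powR_ge0//.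
  apply: (ge0_ler_powR (ltW p0) min0); first by rewrite nnegrE ltW.
  by rewrite ge_min lexx orbT.
rewrite lef_pV2 ?posrE ?powR_gt0//; last exact: lt_le_trans de.
apply: ge0_ler_powR; rewrite ?nnegrE ?enorm_ge0 ?ltW//.
exact: lt_le_trans de.
Qed.

Let powR_exp (x e : R) j : 0 <= x -> (x `^ e) ^+ j = (x ^+ j) `^ e.
Proof. by move=> x0; rewrite -powR_mulrn ?powR_ge0// powRAC powR_mulrn. Qed.

Let powRq (x : R) : 0 < x -> x `^ q = x ^+ N * x `^ (s * p).
Proof. by move=> x0; rewrite powRD ?powR_mulrn ?ltW// gt_eqF// implybT. Qed.

(** The volume factor rin^N cancels the N in the exponent q; as L * lam = E, what remains is E^p
    lam^(-s p) times 2^(-j (p - s p)). *)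
Let cinE j : cin j * (2 * (8 * R0 * rin j) ^+ N) = A * M * a ^+ j.
Proof.
rewrite /cin /A /M /a powR_exp ?invr_ge0//.
have -> : L * rin j = E * 2^-1 ^+ j.
  by rewrite /rin mulrA /lam mulrC [L * _]mulrC divfK ?gt_eqF// mulrC.
rewrite /rin; set t := 2^-1 ^+ j.
have t0 : 0 < t by rewrite exprn_gt0.
rewrite (powRM p (ltW E0) (ltW t0)) (powRM q (ltW (mulr_gt0 lam0 t0))) ?invr_ge0//.
rewrite (powRM q (ltW lam0) (ltW t0)).
rewrite (powRq lam0) (powRq t0) !exprMn.
rewrite powRB ?gt_eqF ?implybT//; last by rewrite gtr_pMl.
rewrite (powRN lam).
rewrite -(powR_inv1 (ler0n R 2)) -powRrM mulN1r powRN.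
have ne0 : L^-1 ^+ N != 0 by rewrite expf_neq0// invr_neq0// gt_eqF.
have ne1 : E ^+ N != 0 by rewrite expf_neq0// gt_eqF.
have ne2 : t ^+ N != 0 by rewrite expf_neq0// gt_eqF.
have ne3 : lam `^ (s * p) != 0 by rewrite gt_eqF ?powR_gt0.
have ne4 : t `^ (s * p) != 0 by rewrite gt_eqF ?powR_gt0.
have ne5 : 2 `^ q != 0 :> R by rewrite gt_eqF ?powR_gt0.
by field; rewrite ?ne0 ?ne1 ?ne2 ?ne3 ?ne4 ?ne5.
Qed.

Let coutE j : cout j * (2 * (8 * R0 * rout j.+1) ^+ N) = B * M * b ^+ j.
Proof.
rewrite /cout /B /M /b powR_exp// /rout exprS; set t := 2 ^+ j.
have t0 : 0 < t by rewrite exprn_gt0.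
rewrite (powRM q (ltW lam0) (ltW t0)) (powRq lam0) (powRq t0) !powRN.
have -> : 8 * R0 * (lam * (2 * t)) = 16 * (R0 * lam * t) by ring.
rewrite !exprMn.
have ne0 : L^-1 ^+ N != 0 by rewrite expf_neq0// invr_neq0// gt_eqF.
have ne1 : E ^+ N != 0 by rewrite expf_neq0// gt_eqF.
have ne2 : t ^+ N != 0 by rewrite expf_neq0// gt_eqF.
have ne3 : lam `^ (s * p) != 0 by rewrite gt_eqF ?powR_gt0.
have ne4 : t `^ (s * p) != 0 by rewrite gt_eqF ?powR_gt0.
by field; rewrite ?ne0 ?ne1 ?ne2 ?ne3 ?ne4.
Qed.

Lemma int_truncated_kernel_le : 0 <= R0 ->
  (int_RN_RN (fun x y : 'rV[R]_N => (truncated_kernel s p R0 L E x y)%:E) <=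
   ((A / (1 - a) + B / (1 - b)) * M)%:E)%E.
Proof.
move=> R00.
have mshell j : pmeas (shell j).
  by apply: pmeasD; apply: pmeasZ; exact: pmeas_near_ball.
have M0 : 0 <= M by rewrite !mulr_ge0 ?powR_ge0 ?exprn_ge0.
have A0 : 0 <= A by rewrite !mulr_ge0 ?powR_ge0 ?exprn_ge0.
have B0 : 0 <= B by rewrite !mulr_ge0 ?exprn_ge0.
have a0 : 0 <= a by exact: powR_ge0.
have b0 : 0 <= b by exact: powR_ge0.
have sp0 : 0 < s * p by exact: mulr_gt0.
have pow1 (e : R) : 1 `^ e = 1 by rewrite powR1.
have b1 : b < 1.
  rewrite /b powRN invf_lt1 ?powR_gt0// -[ltLHS](pow1 (s * p)).
  by apply: gt0_ltr_powR; rewrite ?nnegrE ?ltr1n.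
have a1 : a < 1.
  rewrite /a -[ltRHS](pow1 (p - s * p)).
  apply: gt0_ltr_powR; rewrite ?nnegrE ?invr_ge0 ?invf_lt1 ?ltr1n//.
  by rewrite subr_gt0 gtr_pMl.
apply: (@le_trans _ _ (int_RN_RN (fun x y => \sum_(j <oo) shell j x y)%E)).
  apply: int_pair_le.
  - by move=> x y; rewrite lee_fin truncated_kernel_ge0.
  - by move=> x y; exact: kernel_le_shells.
  - exact: pmeas_truncated_kernel.
  - exact: pmeas_series.
rewrite int_pair_series//.
apply: (@le_trans _ _ (\sum_(j <oo) ((A * M * a ^+ j + B * M * b ^+ j)%:E))%E).
  apply: lee_nneseries => [j _ _|j _]; first exact: int_pair_ge0.
  have ind0 r x y : (0 <= (near_ball R0 r x y)%:R%:E :> \bar R)%E by rewrite lee_fin.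
  have mi r : pmeas (fun x y : 'rV[R]_N => (near_ball R0 r x y)%:R%:E) by exact: pmeas_near_ball.
  rewrite int_pairD//; first last.
  - exact: pmeasZ.
  - exact: pmeasZ.
  - by move=> x y; rewrite mule_ge0 ?lee_fin.
  - by move=> x y; rewrite mule_ge0 ?lee_fin.
  rewrite !int_pairZ// -cinE -coutE EFinD (EFinM (cin j)) (EFinM (cout j)).
  apply: leeD; apply: lee_wpmul2l; rewrite ?lee_fin//;
    exact: int_near_ball R00 (ltW _).
apply: lime_le.
  apply: is_cvg_nneseries => j _ _.
  by rewrite lee_fin addr_ge0// mulr_ge0 ?exprn_ge0// mulr_ge0.
apply: nearW => n; rewrite sumEFin lee_fin big_split /= -!mulr_sumr.
rewrite mulrDl; apply: lerD.
  rewrite [leRHS]mulrAC; apply: ler_wpM2l; first exact: mulr_ge0.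
  exact: geometric_partial_sum_le.
rewrite [leRHS]mulrAC; apply: ler_wpM2l; first exact: mulr_ge0.
exact: geometric_partial_sum_le.
Qed.

End dyadic_shells.
End truncated_kernel.

(** * Smooth functions with compact support *)

Section flat_functions.
Context {R : realType}.
Implicit Types (q : {poly R}) (t : R).

(** A single Taylor term of e^z gives z^n e^(-z) <= n!; the monomials are then summed with the
    absolute values of the coefficients. *)
Lemma poly_expR_bounded q : exists C, 0 <= C /\
  forall z : R, 0 < z -> `|q.[z]| * expR (- z) <= C.
Proof.
have monomial (n : nat) (z : R) : 0 < z -> z ^+ n * expR (- z) <= n`!%:R.
  move=> z0; rewrite expRN ler_pdivrMr ?expR_gt0//.
  case: n => [|n]; first by rewrite expr0 fact0 mul1r -[leLHS]expR0 ler_expR ltW.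
  have := expR_ge1Dxn n (ltW z0); rewrite -lerBrDl => h.
  have {}h : z ^+ n.+1 / (n.+1)`!%:R <= expR z by rewrite (le_trans h)// gerBl.
  by rewrite mulrC -ler_pdivrMr ?ltr0n ?fact_gt0.
exists (\sum_(i < size q) `|q`_i| * i`!%:R); split.
  by apply: sumr_ge0 => i _; rewrite mulr_ge0.
move=> z z0; rewrite horner_coef.
apply: (@le_trans _ _ ((\sum_(i < size q) `|q`_i * z ^+ i|) * expR (- z))).
  by rewrite ler_wpM2r ?expR_ge0// ler_norm_sum.
rewrite mulr_suml; apply: ler_sum => i _.
rewrite normrM -mulrA ler_wpM2l//.
by rewrite (ger0_norm (exprn_ge0 _ (ltW z0))) monomial.
Qed.

(* All derivatives of exp(-1/t) for t > 0 have this form. *)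
Definition flat q t : R := if 0 < t then q.[t^-1] * expR (- t^-1) else 0.

(** With z = 1/t one has d/dt = - z^2 d/dz, and d/dz of q(z) e^(-z) is (q' - q) e^(-z). *)
Definition flat_deriv q : {poly R} := 'X^2 * (q - q^`()).

Lemma flat_le0 q t : t <= 0 -> flat q t = 0.
Proof. by rewrite /flat leNgt; case: ifP. Qed.

Lemma flat_bounded q : exists C, 0 <= C /\ forall t, `|flat q t| <= C.
Proof.
have [C [C0 hC]] := poly_expR_bounded q.
exists C; split => // t; rewrite /flat; case: ifPn => t0; last by rewrite normr0.
by rewrite normrM (ger0_norm (expR_ge0 _)) hC// invr_gt0.
Qed.

(** Serves differentiability at 0: the difference quotient there is O(h), so the two branches glue
    with derivative 0. The bound is that of [poly_expR_bounded] for q X^2. *)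
Lemma flat_quadratic q : exists C, 0 <= C /\ forall t, `|flat q t| <= C * t ^+ 2.
Proof.
have [C [C0 hC]] := poly_expR_bounded (q * 'X^2).
exists C; split => // t; rewrite /flat; case: ifPn => t0; last first.
  by rewrite normr0 mulr_ge0// sqr_ge0.
rewrite normrM (ger0_norm (expR_ge0 _)).
have := hC t^-1; rewrite invr_gt0 => /(_ t0).
have tV : 0 <= t^-1 ^+ 2 by rewrite sqr_ge0.
rewrite hornerM hornerXn normrM (ger0_norm tV).
by rewrite exprVn mulrAC ler_pdivrMr// exprn_gt0.
Qed.

Lemma is_derive_flat q t : is_derive t 1 (flat q) (flat (flat_deriv q) t).
Proof.
have [t0|t0|->] := ltgtP t 0.
- rewrite (flat_le0 (flat_deriv q) (ltW t0)).
  apply: (@near_eq_is_derive _ _ _ (cst 0)).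
  near=> x; rewrite flat_le0//; apply/ltW; near: x; exact: lt_nbhsl.
- have tn0 : t != 0 by rewrite gt_eqF.
  apply: (@near_eq_is_derive _ _ _ ((horner q \o GRing.inv) * (expR \o - (GRing.inv : R -> R)))).
    near=> x; rewrite /flat ifT//; near: x; exact: lt_nbhsr.
  have dV : is_derive t 1 (GRing.inv : R -> R) (- t ^- 2).
    apply: DeriveDef; first exact: derivableV.
    by rewrite (deriveV (f := id))// derive_id scaler1.
  have dNV : is_derive t 1 (- (GRing.inv : R -> R)) (t ^- 2).
    by rewrite -[t ^- 2]opprK; apply: is_deriveN.
  apply: is_derive_eq.
  rewrite /flat t0 /flat_deriv /= !hornerE /= /GRing.scale /=.
  by rewrite -exprVn; ring.
- rewrite (flat_le0 (flat_deriv q) (lexx 0)).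
  have [C [C0 hC]] := flat_quadratic q.
  have lim0 : h^-1 *: ((flat q \o shift 0) (h *: 1) - flat q 0) @[h --> 0^'] --> (0 : R).
    apply/cvgrPdist_le => e e0; near=> h.
    have h0 : h != 0 by near: h; exact: nbhs_dnbhs_neq.
    rewrite sub0r normrN /= (flat_le0 q (lexx 0)) subr0 addr0 normrM normfV /GRing.scale /= mulr1.
    rewrite mulrC ler_pdivrMr ?normr_gt0//.
    apply: le_trans (hC h) _.
    rewrite -real_normK ?num_real// expr2 mulrA ler_wpM2r//.
    rewrite (@le_trans _ _ ((C + 1) * `|h|))// ?ler_wpM2r ?lerDl//.
    rewrite mulrC -ler_pdivlMr ?ltr_wpDl//.
    near: h; apply: dnbhs0_le; rewrite divr_gt0// ltr_wpDl//.
  by apply: DeriveDef; [apply/cvg_ex; exists 0|exact/cvg_lim].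
Unshelve. all: by end_near. Qed.

Lemma continuous_flat q : continuous (flat q).
Proof.
move=> t; apply/differentiable_continuous/derivable1_diffP.
by have [] := is_derive_flat q t.
Qed.

(** The derivative is again of the form [flat], hence bounded, and the mean value theorem
    applies. *)
Lemma flat_lipschitz q : exists C, 0 <= C /\
  forall a b : R, `|flat q a - flat q b| <= C * `|a - b|.
Proof.
have [C [C0 hC]] := flat_bounded (flat_deriv q).
exists C; split => // a b.
wlog ab : a b / a < b.
  move=> h; have [ab|ab|->] := ltgtP a b; first exact: h.
    by rewrite distrC [`|a - b|]distrC; exact: h.
  by rewrite !subrr normr0 mulr0.
have cf : {within `[a, b], continuous (flat q)}.
  by apply: continuous_subspaceT; exact: continuous_flat.
have [c _ e] := MVT ab (fun x _ => is_derive_flat q x) cf.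
by rewrite distrC e normrM [`|b - a|]distrC ler_wpM2r.
Qed.

Lemma flat1_ge0 t : 0 <= flat 1 t.
Proof. by rewrite /flat; case: ifP => // _; rewrite hornerC mul1r expR_ge0. Qed.

Lemma flat1_le1 t : flat 1 t <= 1.
Proof.
rewrite /flat; case: ifPn => // t0.
by rewrite hornerC mul1r -[leRHS]expR0 ler_expR oppr_le0 invr_ge0 ltW.
Qed.

Lemma flat1_gt0 t : 0 < t -> 0 < flat 1 t.
Proof. by move=> t0; rewrite /flat t0 hornerC mul1r expR_gt0. Qed.

Lemma flat1_nondecreasing : {homo flat 1 : a b / a <= b}.
Proof.
move=> a b ab; have [a0|a0] := leP a 0; first by rewrite (flat_le0 1 a0) flat1_ge0.
have b0 := lt_le_trans a0 ab.
by rewrite /flat a0 b0 !hornerC !mul1r ler_expR lerN2 lef_pV2.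
Qed.

End flat_functions.

(** A class of continuous functions that contains the shifted bumps and is stable under directional
    derivatives; smoothness to all orders is then an induction on the list of directions. *)
Inductive flat_algebra {R : realType} {N : nat} : ('rV[R]_N -> R) -> Prop :=
| flat_algebra_cst c : flat_algebra (fun=> c)
| flat_algebra_gen q a c i : flat_algebra (fun x => flat q (a * x ord0 i + c))
| flat_algebraD f g : flat_algebra f -> flat_algebra g -> flat_algebra (fun x => f x + g x)
| flat_algebraM f g : flat_algebra f -> flat_algebra g -> flat_algebra (fun x => f x * g x).

Section smooth_flat_algebra.
Context {R : realType} {N : nat}.
Implicit Types f g : 'rV[R]_N -> R.

Lemma is_derive_along_line f (x v : 'rV[R]_N) (d : R) :
  is_derive (0 : R) 1 (fun h : R => f (h *: v + x)) d -> is_derive x v f d.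
Proof.
move=> [df dE]; apply: DeriveDef; first exact/derivable1P.
rewrite -dE /derive; set g1 := fun h => h^-1 *: _; set g2 := fun h => h^-1 *: _.
suff -> : g1 = g2 by [].
apply/funext => h; rewrite /g1 /g2 /=.
by rewrite addr0 scale0r add0r [_%:A]mulr1.
Qed.

Lemma flat_algebra_derive f : flat_algebra f -> forall v,
  exists2 g, flat_algebra g & forall x, is_derive x v f (g x).
Proof.
elim=> {f} [c|q a c i|f g _ IHf _ IHg|f g fa IHf ga IHg] v.
- by exists (fun=> 0) => [|x]; [exact: flat_algebra_cst|exact: is_derive_cst].
- exists (fun x => (a * v ord0 i) * flat (flat_deriv q) (a * x ord0 i + c)).
    by apply: flat_algebraM; [exact: flat_algebra_cst|exact: flat_algebra_gen].
  move=> x; apply: is_derive_along_line.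
  rewrite (_ : (fun h => _) = flat q \o (fun h => (a * v ord0 i) * h + (a * x ord0 i + c))); last first.
    by apply/funext => h /=; rewrite !mxE; congr flat; ring.
  set k := fun h : R => (a * v ord0 i) * h + (a * x ord0 i + c).
  have dk : is_derive (0 : R) 1 k (a * v ord0 i).
    have dZ : is_derive (0 : R) 1 ((a * v ord0 i) \*: (id : R -> R)) ((a * v ord0 i) *: (1 : R)).
      exact: is_deriveZ.
    have := is_deriveD dZ (is_derive_cst (a * x ord0 i + c : R) (0 : R) 1).
    by rewrite addr0 /GRing.scale /= mulr1; apply.
  have := is_derive1_comp (is_derive_flat q (k 0)) dk.
  by rewrite mulrC {2}/k mulr0 add0r.
- have [f' f'a df] := IHf v; have [g' g'a dg] := IHg v.
  exists (fun x => f' x + g' x); first exact: flat_algebraD.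
  by move=> x; apply: is_deriveD.
have [f' f'a df] := IHf v; have [g' g'a dg] := IHg v.
exists (fun x => f x * g' x + g x * f' x).
  by apply: flat_algebraD; exact: flat_algebraM.
by move=> x; apply: is_deriveM.
Qed.

Lemma flat_algebra_continuous f : flat_algebra f -> continuous f.
Proof.
elim=> {f} [c|q a c i|f g _ cf _ cg|f g _ cf _ cg] x.
- exact: cst_continuous.
- apply: (@continuous_comp _ _ _ (fun x : 'rV[R]_N => a * x ord0 i + c) (flat q)).
    apply: (@continuousD _ _ _ (fun x : 'rV[R]_N => a * x ord0 i) (fun=> c)); last exact: cst_continuous.
    apply: (@continuousM _ _ (fun=> a) (fun x : 'rV[R]_N => x ord0 i)); first exact: cst_continuous.
    exact: coord_continuous.
  exact: continuous_flat.
- exact: (continuousD (cf x) (cg x)).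
- exact: (continuousM (cf x) (cg x)).
Qed.

Lemma flat_algebra_smooth f : flat_algebra f -> smooth f.
Proof.
move=> fa l.
have da : flat_algebra (diter l f).
  elim: l => [//|v l IH] /=.
  have [g ga dg] := flat_algebra_derive IH v.
  rewrite (_ : derive _ ^~ v = g)//; apply/funext => x.
  by have [] := dg x.
split; first exact: flat_algebra_continuous.
by move=> v x; have [g _ dg] := flat_algebra_derive da v; have [] := dg x.
Qed.

Lemma flat_algebra_sum (I : Type) (r : seq I) (F : I -> 'rV[R]_N -> R) :
  (forall i, flat_algebra (F i)) -> flat_algebra (fun x => \sum_(i <- r) F i x).
Proof.
move=> Fa; elim: r => [|i r IH].
  under eq_fun do rewrite big_nil; exact: flat_algebra_cst.
by under eq_fun do rewrite big_cons; exact: flat_algebraD.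
Qed.

Lemma flat_algebra_prod (I : Type) (r : seq I) (F : I -> 'rV[R]_N -> R) :
  (forall i, flat_algebra (F i)) -> flat_algebra (fun x => \prod_(i <- r) F i x).
Proof.
move=> Fa; elim: r => [|i r IH].
  under eq_fun do rewrite big_nil; exact: flat_algebra_cst.
by under eq_fun do rewrite big_cons; exact: flat_algebraM.
Qed.

End smooth_flat_algebra.

Section bump.
Context {R : realType} {N : nat}.
Implicit Types (x y z : 'rV[R]_N) (r : R).

(** For r > 0 the i-th factor is positive exactly when |x_i| < r, so the support is a cube. The mass
    is not normalized here; the lattice sum [Z] does this later. *)
Definition bump r x : R :=
  \prod_(i < N) (flat 1 (x ord0 i / r + 1) * flat 1 (1 - x ord0 i / r)).

Lemma flat_algebra_bump_shift r z : flat_algebra (fun x => bump r (x - z)).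
Proof.
apply: flat_algebra_prod => i; apply: flat_algebraM.
  rewrite (_ : (fun x => _) = fun x : 'rV[R]_N => flat 1 (r^-1 * x ord0 i + (1 - z ord0 i / r))).
    exact: flat_algebra_gen.
  by apply/funext => x; rewrite !mxE; congr flat; ring.
rewrite (_ : (fun x => _) = fun x : 'rV[R]_N => flat 1 (- r^-1 * x ord0 i + (1 + z ord0 i / r))).
  exact: flat_algebra_gen.
by apply/funext => x; rewrite !mxE; congr flat; ring.
Qed.

Lemma bump_ge0 r x : 0 <= bump r x.
Proof. by apply: prodr_ge0 => i _; rewrite mulr_ge0 ?flat1_ge0. Qed.

Lemma bump_le1 r x : bump r x <= 1.
Proof.
apply: prodr_ile1 => i _.
by rewrite mulr_ge0 ?flat1_ge0//= mulr_ile1 ?flat1_ge0 ?flat1_le1.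
Qed.

Lemma bump_eq0 r x : 0 < r -> r <= `|x| -> bump r x = 0.
Proof.
move=> r0 rx.
have [//|[i j] /= xE] := @mx_norm_neq0 R _ _ x.
  by rewrite gt_eqF// (lt_le_trans r0).
rewrite -[`|x|]/(mx_norm x) xE ord1 ler_normr in rx.
rewrite /bump (bigD1 j)//=.
suff -> : flat 1 (x ord0 j / r + 1) * flat 1 (1 - x ord0 j / r) = 0 by rewrite mul0r.
case/orP: rx => rx; [rewrite mulrC|]; rewrite flat_le0 ?mul0r//.
  by rewrite subr_le0 ler_pdivlMr// mul1r.
by rewrite -lerBrDr sub0r ler_pdivrMr// mulN1r lerNr.
Qed.

(** On the half cube all arguments of [flat 1] are at least 1/2, so the bound depends on N only; it
    serves to bound the mass [Z] from below. *)
Lemma bump_ge r x : 0 < r -> `|x| <= r / 2 -> (flat 1 (2^-1) ^+ 2) ^+ N <= bump r x.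
Proof.
move=> r0 xr.
rewrite -[X in _ ^+ X <= _]card_ord -prodr_const.
apply: ler_prod => i _; rewrite sqr_ge0 /=.
have xi : `|x ord0 i / r| <= 2^-1.
  rewrite normrM normfV (gtr0_norm r0) ler_pdivrMr// mulrC.
  by apply: (rV_norm_leP _ _ _) => //; rewrite divr_ge0// ltW.
move: xi; rewrite ler_norml => /andP[x1 x2].
by rewrite expr2; apply: ler_pM; rewrite ?flat1_ge0//; apply: flat1_nondecreasing; lra.
Qed.

(** Telescoping: exchanging one factor costs its difference, the other factors being at most 1. *)
Lemma norm_prodB_le (I : Type) (s : seq I) (a b : I -> R) :
  (forall i, 0 <= a i <= 1) -> (forall i, 0 <= b i <= 1) ->
  `|\prod_(i <- s) a i - \prod_(i <- s) b i| <= \sum_(i <- s) `|a i - b i|.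
Proof.
move=> ha hb; elim: s => [|i s IH]; first by rewrite !big_nil subrr normr0.
rewrite !big_cons; set A := \prod_(j <- s) a j; set B := \prod_(j <- s) b j.
have A1 : `|A| <= 1.
  by rewrite ger0_norm ?prodr_ile1 ?prodr_ge0// => j _; have /andP[] := ha j.
have bi : `|b i| <= 1 by have /andP[b0 b1] := hb i; rewrite ger0_norm.
have -> : a i * A - b i * B = (a i - b i) * A + b i * (A - B) by ring.
apply: le_trans (ler_normD _ _) _; rewrite !normrM; apply: lerD.
  by rewrite ler_piMr.
by apply: le_trans IH; rewrite ler_piMl.
Qed.

Lemma bump_lipschitz : exists C, 0 <= C /\ forall r x y, 0 < r ->
  `|bump r x - bump r y| <= C / r * `|x - y|.
Proof.
have [C [C0 hC]] := @flat_lipschitz R 1.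
exists (N%:R * (C + C)); split; first by rewrite mulr_ge0// addr_ge0.
move=> r x y r0.
have b01 (z : 'rV[R]_N) (i : 'I_N) :
    0 <= flat 1 (z ord0 i / r + 1) * flat 1 (1 - z ord0 i / r) <= 1.
  by rewrite mulr_ge0 ?flat1_ge0//= mulr_ile1 ?flat1_ge0 ?flat1_le1.
apply: le_trans (norm_prodB_le _ (b01 x) (b01 y)) _.
rewrite -!mulrA mulr_natl -[X in _ *+ X]card_ord -sumr_const.
apply: ler_sum => i _.
have xy : `|x ord0 i / r - y ord0 i / r| <= r^-1 * `|x - y|.
  rewrite -mulrBl normrM normfV (gtr0_norm r0) mulrC ler_wpM2l ?invr_ge0 ?(ltW r0)//.
  by have := elimT (rV_norm_leP (x - y) (normr_ge0 _)) (lexx _) i; rewrite !mxE.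
set a1 := flat 1 (x ord0 i / r + 1); set a2 := flat 1 (1 - x ord0 i / r).
set b1 := flat 1 (y ord0 i / r + 1); set b2 := flat 1 (1 - y ord0 i / r).
have -> : a1 * a2 - b1 * b2 = (a1 - b1) * a2 + b1 * (a2 - b2) by ring.
apply: le_trans (ler_normD _ _) _; rewrite !normrM mulrDl; apply: lerD.
  apply: (@le_trans _ _ `|a1 - b1|).
    by rewrite ler_piMr// ger0_norm ?flat1_ge0 ?flat1_le1.
  apply: le_trans (hC _ _) _; rewrite ler_wpM2l//.
  by rewrite (le_trans _ xy)// opprD addrACA subrr addr0.
apply: (@le_trans _ _ `|a2 - b2|).
  by rewrite ler_piMl// ger0_norm ?flat1_ge0 ?flat1_le1.
apply: le_trans (hC _ _) _; rewrite ler_wpM2l//.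
rewrite (le_trans _ xy)//.
by rewrite opprD addrACA subrr add0r -opprD normrN.
Qed.

End bump.

(** * Mollification along a lattice *)

Section lattice.
Context {R : realType} {N : nat}.
Implicit Types (k m : 'rV[int]_N) (x : 'rV[R]_N) (h : R).

(** Finite functions into 0..2K, shifted by K, list the integer points of the cube of half-side K
    without repetition, so that both the count and the reindexing are explicit. *)
Definition lattice_box (K : nat) : seq 'rV[int]_N :=
  [seq \row_(i < N) ((f i : nat)%:Z - K%:Z) | f : {ffun 'I_N -> 'I_(K + K).+1}].

Definition lattice_point h k : 'rV[R]_N := h *: map_mx intr k.

Lemma lattice_pointB h k m : lattice_point h (k - m) = lattice_point h k - lattice_point h m.
Proof. by apply/rowP => i; rewrite !mxE intrB mulrBr. Qed.

Lemma mem_lattice_box K k : (k \in lattice_box K) = [forall i, `|k ord0 i| <= K%:Z].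
Proof.
apply/mapP/forallP => [[f _ ->] i|h].
  rewrite mxE; have := ltn_ord (f i); rewrite ltnS.
  move: (nat_of_ord (f i)) => z zK; rewrite ler_norml; apply/andP.
  by split; lia.
have b i : (absz (k ord0 i + K%:Z)%R < (K + K).+1)%N.
  by have := h i; rewrite ler_norml => /andP[]; lia.
exists [ffun i => Ordinal (b i)]; first by rewrite mem_enum.
apply/rowP => i; rewrite mxE ffunE /= (_ : 0 = ord0 :> 'I_1); last exact: val_inj.
by have := h i; rewrite ler_norml => /andP[]; lia.
Qed.

Lemma mem_lattice_boxE h K k : 0 < h ->
  (k \in lattice_box K) = (`|lattice_point h k| <= h * K%:R).
Proof.
move=> h0; rewrite mem_lattice_box.
have hK : 0 <= h * K%:R by rewrite mulr_ge0// ltW.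
have E i : (`|lattice_point h k ord0 i| <= h * K%:R) = (`|k ord0 i| <= K%:Z).
  rewrite !mxE normrM (gtr0_norm h0) ler_pM2l// -intr_norm.
  by rewrite -[K%:R]/(K%:Z%:~R) ler_int.
by apply/forallP/(rV_norm_leP _ hK) => H i; have := H i; rewrite E.
Qed.

Lemma uniq_lattice_box K : uniq (lattice_box K).
Proof.
rewrite map_inj_uniq ?enum_uniq// => f g /rowP fg.
apply/ffunP => i; apply/val_inj; have := fg i; rewrite !mxE /=; lia.
Qed.

Lemma size_lattice_box K : size (lattice_box K) = ((K + K).+1 ^ N)%N.
Proof. by rewrite size_map -cardE card_ffun !card_ord. Qed.

(** Discrete form of the change of variables y -> m - y in a convolution. The two support hypotheses
    ensure that the finite box truncates neither sum. *)
Lemma lattice_box_reindex (a : 'rV[int]_N -> R) m K :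
  (forall k, a k != 0 -> k \in lattice_box K) ->
  (forall k, a (m - k) != 0 -> k \in lattice_box K) ->
  \sum_(k <- lattice_box K) a (m - k) = \sum_(k <- lattice_box K) a k.
Proof.
move=> ha hma.
have supp (b : 'rV[int]_N -> R) :
    \sum_(k <- lattice_box K) b k = \sum_(k <- lattice_box K | b k != 0) b k.
  rewrite [RHS]big_mkcond; apply: eq_bigr => k _.
  by case: ifPn => // /negbNE/eqP.
rewrite supp [RHS]supp -big_filter -[RHS]big_filter.
rewrite -(big_map (fun k => m - k) xpredT a); apply: perm_big.
apply: uniq_perm.
- by rewrite map_inj_uniq ?filter_uniq ?uniq_lattice_box// => k k' /addrI/oppr_inj.
- by rewrite filter_uniq ?uniq_lattice_box.
move=> k; rewrite mem_filter; apply/mapP/andP => [[j]|[ak kK]].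
  by rewrite mem_filter => /andP[aj jK] ->; split => //; exact: ha.
exists (m - k); last by rewrite opprB addrCA subrr addr0.
have E : m - (m - k) = k by rewrite opprB addrCA subrr addr0.
by rewrite mem_filter E ak /=; apply: hma; rewrite E.
Qed.

Lemma lattice_box_sum_ge (F : 'rV[int]_N -> R) (n K : nat) (c : R) :
  (forall k, 0 <= F k) -> (n <= K)%N -> (forall k, k \in lattice_box n -> c <= F k) ->
  c * (size (lattice_box n))%:R <= \sum_(k <- lattice_box K) F k.
Proof.
move=> F0 nK hc.
rewrite (bigID (mem (lattice_box n)))/= ler_wpDr ?sumr_ge0//.
rewrite -big_filter.
rewrite (perm_big (lattice_box n)); last first.
  apply: uniq_perm; rewrite ?filter_uniq ?uniq_lattice_box// => k.
  rewrite mem_filter andb_idr// !mem_lattice_box => /forallP h.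
  by apply/forallP => i; rewrite (le_trans (h i))// lez_nat.
rewrite -sum1_size natr_sum mulr_sumr [leLHS]big_seq [leRHS]big_seq.
by apply: ler_sum => k kn; rewrite mulr1 hc.
Qed.

Lemma lattice_floor h x : 0 < h ->
  `|x - lattice_point h (\row_i Num.floor (x ord0 i / h))| <= h.
Proof.
move=> h0; apply/rV_norm_leP; first exact: ltW.
move=> i; rewrite !mxE.
have := floor_le (x ord0 i / h); rewrite ler_pdivlMr// => h1.
have := floorD1_gt (x ord0 i / h); rewrite ltr_pdivrMr// => /ltW.
rewrite intrD mulrDl mul1r => h2.
by rewrite ger0_norm ?subr_ge0 mulrC// lerBlDl.
Qed.

End lattice.

(** Compares, per coordinate, the box of half-side 2n(Q+3) with that of half-side n. The constant is
    4(Q+3)+1, the side of the larger box for n = 1; that it is free of n is what keeps the Lipschitz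
    constant independent of the mesh. *)
Lemma mesh_count (n Q : nat) : (0 < n)%N ->
  ((2 * n * (Q + 3) + 2 * n * (Q + 3)).+1 <= (4 * Q + 13) * (n + n).+1)%N.
Proof.
move=> n0; have -> : (2 * n * (Q + 3) = 2 * (n * Q) + 6 * n)%N by rewrite mulnDr -!mulnA; lia.
have -> : ((4 * Q + 13) * (n + n).+1 = 8 * (n * Q) + 4 * Q + 26 * n + 13)%N.
  by rewrite mulnDl -mulnA mulnS addnn -mul2n mulnCA [(Q * n)%N]mulnC; lia.
by lia.
Qed.

Section discrete_mollification.
Context {R : realType} {N : nat}.
Variables (f : 'rV[R]_N -> R) (M r : R) (Q : nat).
Hypotheses (r0 : 0 < r) (fM : forall x, `|f x| <= M)
  (f0 : forall x, r * Q%:R < `|x| -> f x = 0)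
  (fuc : forall e : R, 0 < e -> exists2 d, 0 < d &
     forall x y, `|x - y| <= d -> `|f x - f y| <= e).

(* The ratio of the number of lattice points to the mass of the bump does not
   depend on the mesh, so the mollifications are uniformly Lipschitz. *)
Lemma discrete_mollification : exists2 L, 0 < L & forall eps, 0 < eps ->
  exists (s : seq 'rV[int]_N) (w : 'rV[int]_N -> R) (t : 'rV[int]_N -> 'rV[R]_N)
    (g : 'rV[R]_N -> R),
  [/\ (forall k, 0 <= w k), \sum_(k <- s) w k = 1,
      (forall k, w k != 0 -> `|t k| <= r) &
  [/\ flat_algebra g, (forall x y, `|g x - g y| <= L * `|x - y|),
      (forall x, r * Q.+1%:R < `|x| -> g x = 0) &
      (forall x, `|g x - \sum_(k <- s) w k * f (x - t k)| <= eps)]].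
Proof.
have M0 : 0 <= M by exact: le_trans (fM 0).
have [C [C0 Clip]] := @bump_lipschitz R N.
pose b : R := (flat 1 (2^-1) ^+ 2) ^+ N.
have b0 : 0 < b by rewrite !exprn_gt0// flat1_gt0.
(* [D] will bound the number of lattice points divided by the mass [Z]: the points of the half cube
   alone contribute at least [b] each to [Z]. *)
pose D : R := (4 * Q + 13)%:R ^+ N / b.
have D0 : 0 < D by rewrite divr_gt0// exprn_gt0// ltr0n addnC.
pose lip := C / r.
have lip0 : 0 <= lip by rewrite divr_ge0// ltW.
have mlD0 : 0 <= M * lip * D by rewrite mulr_ge0 ?(ltW D0)// mulr_ge0.
exists (M * lip * D + 1); first by rewrite ltr_wpDl.
move=> eps eps0.
have e0 : 0 < eps / (2 * D) by rewrite divr_gt0// mulr_gt0.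
have [d d0 hd] := fuc e0.
(* The first summand makes the mesh at most the modulus [d], the second makes M lip h D at most eps
   / 2. *)
pose n0 := Num.truncn (r / d + r * (2 * (M * lip * D)) / eps).
pose n := n0.+1.
pose h := r / 2 / n%:R.
have n_gt0 : (0 : R) < n%:R by rewrite ltr0n.
have h0 : 0 < h by rewrite !divr_gt0.
have rn : r / d + r * (2 * (M * lip * D)) / eps < n%:R by exact: truncnS_gt.
have hr : h * (2 * n)%:R = r.
  by rewrite /h natrM; field; rewrite pnatr_eq0.
have hd' : h <= d.
  have : r / d < n%:R.
    apply: le_lt_trans rn; by rewrite lerDl divr_ge0 ?(ltW eps0)// mulr_ge0 ?(ltW r0)// mulr_ge0.
  rewrite ltr_pdivrMr// => /ltW rd.
  rewrite /h ler_pdivrMr// [d * _]mulrC; apply: le_trans rd.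
  by move: r0; lra.
have he : M * lip * h * D <= eps / 2.
  have : r * (2 * (M * lip * D)) / eps < n%:R.
    by apply: le_lt_trans rn; rewrite lerDr divr_ge0 ?ltW.
  rewrite ltr_pdivrMr// => /ltW rd.
  have -> : M * lip * h * D = (r * (2 * (M * lip * D))) / 4 / n%:R.
    by rewrite /h; field; rewrite pnatr_eq0.
  have X0 : 0 <= r * (2 * (M * lip * D)) by rewrite mulr_ge0 ?(ltW r0)// mulr_ge0.
  rewrite ler_pdivrMr// (_ : eps / 2 * n%:R = n%:R * eps / 2); last by ring.
  by move: X0 rd; set X := r * _; set Y := n%:R * eps; lra.
(* As 2 n h = r, the box has radius r (Q + 3): x reaches r (Q + 1), its rounding [pt m] reaches r (Q
   + 2), and one more r is needed for [pt k] when [pt (m - k)] lies in the support of the bump. *)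
pose K := (2 * n * (Q + 3))%N.
pose pt := @lattice_point R N h.
pose s := @lattice_box N K.
pose Z : R := \sum_(k <- s) bump r (pt k).
have sizeZ : (size s)%:R <= D * Z.
  have h1 : b * (size (@lattice_box N n))%:R <= Z.
    apply: lattice_box_sum_ge => [k||k].
    - exact: bump_ge0.
    - by rewrite /K -mulnA mulnCA leq_pmulr// addnC.
    rewrite (mem_lattice_boxE _ _ h0) => kn; apply: bump_ge => //.
    by apply: le_trans kn _; rewrite /h divfK// pnatr_eq0.
  have h2 : (size s)%:R <= ((4 * Q + 13)%:R ^+ N * (size (@lattice_box N n))%:R : R).
    rewrite !size_lattice_box !natrX -exprMn lerXn2r ?nnegrE ?mulr_ge0// -natrM ler_nat.
    exact: mesh_count.
  apply: le_trans h2 _; rewrite /D mulrAC ler_pdivlMr//.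
  by rewrite -mulrA ler_wpM2l ?exprn_ge0// mulrC.
have Z0 : 0 < Z.
  rewrite -(pmulr_rgt0 _ D0); apply: lt_le_trans sizeZ.
  by rewrite ltr0n size_lattice_box expn_gt0.
have avg_le (F : 'rV[int]_N -> R) (c : R) : 0 <= c -> (forall k, `|F k| <= c) ->
    `|Z^-1 * \sum_(k <- s) F k| <= c * D.
  move=> c0 Fc; rewrite normrM gtr0_norm ?invr_gt0// mulrC ler_pdivrMr//.
  apply: le_trans (ler_norm_sum _ _ _) _.
  apply: (@le_trans _ _ (\sum_(k <- s) c)); first exact: ler_sum.
  rewrite big_const_seq count_predT iter_addr_0 -[leLHS]mulr_natr -mulrA.
  exact: ler_wpM2l.
exists s, (fun k => bump r (pt k) / Z), pt,
  (fun x => Z^-1 * \sum_(k <- s) f (pt k) * bump r (x - pt k)).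
split.
- by move=> k; rewrite divr_ge0 ?bump_ge0// ltW.
- by rewrite -mulr_suml divff// gt_eqF.
- move=> k; rewrite mulf_eq0 negb_or => /andP[bk _]; rewrite leNgt; apply/negP => rk.
  by move: bk; rewrite bump_eq0 ?eqxx// ltW.
split.
- apply: flat_algebraM; first exact: flat_algebra_cst.
  apply: flat_algebra_sum => k; apply: flat_algebraM; first exact: flat_algebra_cst.
  exact: flat_algebra_bump_shift.
- move=> x y; rewrite -mulrBr -sumrB.
  have := avg_le (fun k => f (pt k) * bump r (x - pt k) - f (pt k) * bump r (y - pt k))
    (M * (lip * `|x - y|)).
  have xy0 : 0 <= lip * `|x - y| by rewrite mulr_ge0.
  have B k : `|f (pt k) * bump r (x - pt k) - f (pt k) * bump r (y - pt k)| <= M * (lip * `|x - y|).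
    rewrite -mulrBr normrM ler_pM//; apply: le_trans (Clip _ _ _ r0) _.
    by rewrite opprB addrA subrK.
  move=> /(_ (mulr_ge0 M0 xy0) B) /le_trans; apply.
  have -> : M * (lip * `|x - y|) * D = M * lip * D * `|x - y| by ring.
  by rewrite ler_wpM2r// lerDl.
- move=> x xQ; rewrite big1 ?mulr0// => k _.
  have [kQ|kQ] := ltP (r * Q%:R) `|pt k|; first by rewrite f0 ?mul0r.
  rewrite bump_eq0 ?mulr0//.
  have := lerB_dist x (pt k); move: xQ; rewrite mulrS mulrDr mulr1; lra.
move=> x.
have Fsum : \sum_(k <- s) bump r (pt k) / Z * f (x - pt k) =
    Z^-1 * \sum_(k <- s) bump r (pt k) * f (x - pt k).
  by rewrite mulr_sumr; apply: eq_bigr => k _; rewrite mulrAC mulrC.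
rewrite Fsum.
have ptr k : bump r (pt k) != 0 -> `|pt k| < r.
  by move=> bk; rewrite ltNge; apply: contra_neqN bk => rk; rewrite bump_eq0.
have [xbig|xQ] := ltP (r * Q.+1%:R) `|x|.
  rewrite !big1 ?subrr ?normr0 ?ltW// => k _.
    have [bk|/ptr bk] := eqVneq (bump r (pt k)) 0; first by rewrite bk mul0r.
    rewrite f0 ?mulr0//.
    have := lerB_dist x (pt k); move: xbig; rewrite mulrS mulrDr mulr1; lra.
  have [kQ|kQ] := ltP (r * Q%:R) `|pt k|; first by rewrite f0 ?mul0r.
  rewrite bump_eq0 ?mulr0//.
  have := lerB_dist x (pt k); move: xbig; rewrite mulrS mulrDr mulr1; lra.
(* At a lattice point x the reindexed sum would equal g x. Rounding x to [pt m] moves the argument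
   of the bump and that of f by at most h each; these are the two errors separated below. *)
pose m : 'rV[int]_N := \row_i Num.floor (x ord0 i / h).
have xm : `|x - pt m| <= h by exact: lattice_floor.
have hle : h <= r.
  by rewrite -hr ler_peMr ?(ltW h0)// ler1n muln_gt0.
have hKE : h * K%:R = r * (Q + 3)%:R by rewrite /K natrM mulrA hr.
have memK k : (k \in s) = (`|pt k| <= r * (Q + 3)%:R).
  by rewrite (mem_lattice_boxE _ _ h0) hKE.
have ptm : `|pt m| <= r * (Q + 2)%:R.
  rewrite -(subrK x (pt m)) (le_trans (ler_normD _ _))// distrC.
  by move: xm xQ hle; rewrite -natr1 natrD !mulrDr mulr1; lra.
have -> : \sum_(k <- s) bump r (pt k) * f (x - pt k) =
    \sum_(k <- s) bump r (pt (m - k)) * f (x - pt (m - k)).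
  apply/esym.
  apply: (lattice_box_reindex (a := fun k => bump r (pt k) * f (x - pt k))) => k.
    rewrite mulf_eq0 negb_or => /andP[/ptr bk _]; rewrite memK (le_trans (ltW bk))//.
    by rewrite ler_peMr ?(ltW r0)// ler1n addn3.
  rewrite mulf_eq0 negb_or => /andP[/ptr bk _]; rewrite memK.
  have -> : pt k = pt m - pt (m - k).
    by rewrite -/pt /pt -lattice_pointB opprB addrCA subrr addr0.
  rewrite (le_trans (ler_normB _ _))//.
  by move: bk ptm; rewrite !natrD !mulrDr; lra.
rewrite -mulrBr -sumrB.
have c0 : 0 <= M * (lip * h) + eps / (2 * D).
  by rewrite addr_ge0 ?(ltW e0)// mulr_ge0// mulr_ge0// ltW.
apply: le_trans (avg_le _ _ c0 _) _; last first.
  rewrite mulrDl (_ : M * (lip * h) * D = M * lip * h * D); last by ring.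
  have -> : eps / (2 * D) * D = eps / 2 by field; rewrite gt_eqF.
  by move: he; set X := M * lip * h * D; lra.
move=> k; rewrite (_ : pt (m - k) = pt m - pt k); last exact: lattice_pointB.
have -> : f (pt k) * bump r (x - pt k) - bump r (pt m - pt k) * f (x - (pt m - pt k)) =
    f (pt k) * (bump r (x - pt k) - bump r (pt m - pt k)) +
    (f (pt k) - f (x - (pt m - pt k))) * bump r (pt m - pt k) by ring.
apply: le_trans (ler_normD _ _) _; rewrite !normrM; apply: lerD.
  apply: ler_pM => //; apply: le_trans (Clip _ _ _ r0) _.
  by rewrite ler_wpM2l// opprB addrA subrK.
rewrite -[leRHS]mulr1; apply: ler_pM => //; last first.
  by rewrite ger0_norm ?bump_ge0 ?bump_le1.
apply: hd; apply: le_trans hd'; apply: le_trans xm.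
rewrite (_ : pt k - (x - (pt m - pt k)) = - (x - pt m)) ?normrN//.
by rewrite !opprB addrA addrCA subrr addr0.
Qed.

End discrete_mollification.

(** * Gagliardo seminorm *)

Section power_inequalities.
Context {R : realType} (p : R).
Hypothesis p1 : 1 < p.

Let p0 : 0 < p. Proof. exact: lt_trans p1. Qed.

(** Split at b = t a, where (1 + t)^p = 1 + e. A leading factor arbitrarily close to 1 is essential:
    the perturbed energy must come within any given error of the original one. *)
Lemma powR_add_le (e : R) : 0 < e -> exists2 C, 0 <= C & forall a b : R, 0 <= a -> 0 <= b ->
  (a + b) `^ p <= (1 + e) * a `^ p + C * b `^ p.
Proof.
move=> e0; pose t := (1 + e) `^ p^-1 - 1.
have t0 : 0 < t.
  rewrite subr_gt0 -[X in X < _](_ : 1 `^ p^-1 = 1); last by rewrite powR1.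
  by apply: gt0_ltr_powR; rewrite ?invr_gt0// ?nnegrE ?ltrDl// addr_ge0// ltW.
have te : (1 + t) `^ p = 1 + e.
  by rewrite addrC subrK -powRrM mulVf ?gt_eqF// powRr1// addr_ge0// ltW.
exists ((1 + t^-1) `^ p); first exact: powR_ge0.
move=> a b a0 b0.
have [ba|ab] := leP b (t * a).
  apply: (@le_trans _ _ ((1 + e) * a `^ p)); last by rewrite lerDl mulr_ge0 ?powR_ge0.
  have t1 : 0 <= 1 + t by rewrite addr_ge0// ltW.
  rewrite -te -(powRM _ t1 a0); apply: (ge0_ler_powR (ltW p0)).
  - by rewrite nnegrE addr_ge0.
  - by rewrite nnegrE mulr_ge0.
  - by rewrite mulrDl mul1r lerD2l.
apply: (@le_trans _ _ ((1 + t^-1) `^ p * b `^ p)); last first.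
  by rewrite lerDr mulr_ge0 ?powR_ge0// addr_ge0// ltW.
have tV0 : 0 <= t^-1 by rewrite invr_ge0 ltW.
have tV1 : 0 <= 1 + t^-1 by rewrite addr_ge0.
rewrite -(powRM _ tV1 b0); apply: (ge0_ler_powR (ltW p0)).
- by rewrite nnegrE addr_ge0.
- by rewrite nnegrE mulr_ge0.
by rewrite mulrDl mul1r addrC lerD2l mulrC ler_pdivlMr// mulrC ltW.
Qed.

(* Tangent-line form of Jensen: Young's inequality applied to a_k A^(p-1). *)
Lemma powR_jensen (I : Type) (s : seq I) (w a : I -> R) :
  (forall i, 0 <= w i) -> (forall i, 0 <= a i) -> \sum_(i <- s) w i = 1 ->
  (\sum_(i <- s) w i * a i) `^ p <= \sum_(i <- s) w i * a i `^ p.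
Proof.
move=> w0 a0 w1; set A := \sum_(i <- s) w i * a i.
have A0 : 0 <= A by apply: sumr_ge0 => i _; exact: mulr_ge0.
pose q := p / (p - 1).
have pm1 : 0 < p - 1 by rewrite subr_gt0.
have q0 : 0 < q by exact: divr_gt0.
have pq : p^-1 + q^-1 = 1.
  by rewrite /q invf_div; field; rewrite gt_eqF.
have ApE : A `^ p = \sum_(i <- s) w i * (a i * A `^ (p - 1)).
  rewrite -(mulr_powRB1 A0 p0) {1}/A mulr_suml.
  by apply: eq_bigr => i _; rewrite mulrA.
have young i : a i * A `^ (p - 1) <= a i `^ p / p + A `^ p / q.
  have := @conjugate_powR R (a i) (A `^ (p - 1)) p q (a0 i) (powR_ge0 _ _) p0 q0 pq.
  rewrite -powRrM (_ : (p - 1) * q = p)//.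
  by rewrite /q mulrC divfK// gt_eqF.
have h : A `^ p <= (\sum_(i <- s) w i * a i `^ p) / p + A `^ p / q.
  have -> : A `^ p / q = \sum_(i <- s) w i * (A `^ p / q) by rewrite -mulr_suml w1 mul1r.
  rewrite {1}ApE mulr_suml -big_split /=.
  apply: ler_sum => i _; rewrite -mulrA -mulrDr; exact: ler_wpM2l.
move: h; rewrite -lerBlDr -{1}[A `^ p]mulr1 -mulrBr (_ : 1 - q^-1 = p^-1).
  by rewrite ler_pM2r ?invr_gt0.
by rewrite -pq addrK.
Qed.

End power_inequalities.

Section gagliardo_functional.
Context {R : realType} {N : nat} (s p : R).
Hypotheses (s0 : 0 < s) (s1 : s < 1) (p1 : 1 < p).

Let p0 : 0 < p. Proof. exact: lt_trans p1. Qed.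
Local Notation gag := (@gagliardo_p R N s p).

Definition gagliardo_kernel (u : 'rV[R]_N -> R) (x y : 'rV[R]_N) : R :=
  `|u x - u y| `^ p / enorm (x - y) `^ (N%:R + s * p).

Lemma gagliardo_kernel_ge0 u x y : 0 <= gagliardo_kernel u x y.
Proof. by rewrite divr_ge0 ?powR_ge0. Qed.

Lemma pmeas_gagliardo_kernel u : continuous u ->
  pmeas (fun x y => (gagliardo_kernel u x y)%:E).
Proof. exact: pmeas_gagliardo. Qed.

Lemma gagliardoE u : gag u = int_RN_RN (fun x y => (gagliardo_kernel u x y)%:E).
Proof. by []. Qed.

Lemma gagliardo_ge0 u : (0 <= gag u)%E.
Proof. by apply: int_pair_ge0 => x y; rewrite lee_fin gagliardo_kernel_ge0. Qed.

Lemma gagliardo_translate u (t : 'rV[R]_N) : continuous u ->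
  int_RN_RN (fun x y => (gagliardo_kernel u (x - t) (y - t))%:E) = gag u.
Proof.
move=> cu; rewrite gagliardoE.
apply: (@int_pair_translate _ _ (fun x y => (gagliardo_kernel u x y)%:E)).
  by move=> x y; rewrite lee_fin gagliardo_kernel_ge0.
exact: pmeas_gagliardo_kernel.
Qed.

Lemma pmeas_sum (I : Type) (r : seq I) (F : I -> 'rV[R]_N -> 'rV[R]_N -> \bar R) :
  (forall i, pmeas (F i)) -> pmeas (fun x y => \sum_(i <- r) F i x y)%E.
Proof.
move=> mF; elim: r => [|i r IH] d T a b ma mb.
  under eq_fun do rewrite big_nil; exact: measurable_cst.
under eq_fun do rewrite big_cons.
apply: emeasurable_funD; [exact: mF|exact: IH].
Qed.

Lemma int_pair_sum (I : Type) (r : seq I) (F : I -> 'rV[R]_N -> 'rV[R]_N -> \bar R) :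
  (forall i x y, 0 <= F i x y)%E -> (forall i, pmeas (F i)) ->
  (int_RN_RN (fun x y => \sum_(i <- r) F i x y) = \sum_(i <- r) int_RN_RN (F i))%E.
Proof.
move=> F0 mF; elim: r => [|i r IH].
  rewrite big_nil; transitivity (int_RN_RN (fun _ _ : 'rV[R]_N => 0%E : \bar R)).
    by apply: eq_int_pair => x y; rewrite big_nil.
  exact: iint0.
rewrite big_cons -IH -int_pairD//.
- by apply: eq_int_pair => x y; rewrite big_cons.
- by move=> x y; apply: sume_ge0 => j _; exact: F0.
- exact: pmeas_sum.
Qed.

Lemma pmeas_translate (F : 'rV[R]_N -> 'rV[R]_N -> \bar R) (t : 'rV[R]_N) :
  pmeas F -> pmeas (fun x y => F (x - t) (y - t)).
Proof.
move=> mF d T a b ma mb.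
apply: (mF _ _ (fun z => a z - t) (fun z => b z - t)) => i.
  apply: eq_measurable_fun (measurable_funB (ma i) (measurable_cst (t ord0 i))) => z _.
  by rewrite !mxE.
apply: eq_measurable_fun (measurable_funB (mb i) (measurable_cst (t ord0 i))) => z _.
by rewrite !mxE.
Qed.

Lemma gagliardo_average (I : Type) (r : seq I) (w : I -> R) (t : I -> 'rV[R]_N)
    (u : 'rV[R]_N -> R) (c : R) :
  continuous u -> (forall i, 0 <= w i) -> \sum_(i <- r) w i = 1 ->
  continuous (fun x : 'rV[R]_N => \sum_(i <- r) w i * u (x - t i)) ->
  gag u = c%:E -> (gag (fun x => (\sum_(i <- r) w i * u (x - t i))%R) <= gag u)%E.
Proof.
move=> cu w0 w1 cF guc; rewrite gagliardoE.
pose G i x y := ((w i)%:E * (gagliardo_kernel u (x - t i) (y - t i))%:E)%E.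
have mk i : pmeas (fun x y => (gagliardo_kernel u (x - t i) (y - t i))%:E).
  exact: (pmeas_translate _ (pmeas_gagliardo_kernel cu)).
have G0 i x y : (0 <= G i x y)%E by rewrite mule_ge0// lee_fin// gagliardo_kernel_ge0.
have mG i : pmeas (G i) by exact: pmeasZ.
apply: (@le_trans _ _ (int_RN_RN (fun x y => \sum_(i <- r) G i x y)%E)).
  apply: int_pair_le.
  - by move=> x y; rewrite lee_fin gagliardo_kernel_ge0.
  - move=> x y; rewrite /G; under eq_bigr do rewrite -EFinM.
    rewrite sumEFin lee_fin /gagliardo_kernel.
    have E i : x - t i - (y - t i) = x - y by rewrite opprB addrA subrK.
    under [leRHS]eq_bigr do rewrite E mulrA.
    rewrite -mulr_suml ler_wpM2r ?invr_ge0 ?powR_ge0//.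
    apply: le_trans (powR_jensen p1 w0 (fun i => normr_ge0 _) w1).
    apply: ge0_ler_powR; rewrite ?nnegrE ?(ltW p0)//.
      by apply: sumr_ge0 => i _; rewrite mulr_ge0.
    rewrite -sumrB; apply: le_trans (ler_norm_sum _ _ _) _.
    by apply: ler_sum => i _; rewrite -mulrBr normrM (ger0_norm (w0 i)).
  - exact: pmeas_gagliardo_kernel.
  - exact: pmeas_sum.
rewrite int_pair_sum//.
rewrite (eq_bigr (fun i => (w i * c)%:E)).
  by rewrite sumEFin -mulr_suml w1 mul1r guc.
move=> i _; rewrite /G int_pairZ//; last first.
  by move=> x y; rewrite lee_fin gagliardo_kernel_ge0.
by rewrite gagliardo_translate// guc.
Qed.

(** The integral of [truncated_kernel] up to a constant. Cutoff takes R0 = rho, L = M / rho, E = M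
    and gives M^p rho^(N - s p), small for large rho since s p > N; mollification fixes R0 and L and
    gives a multiple of E^(p - s p), small with E since s < 1. *)
Definition perturbation_size (R0 L E : R) : R :=
  R0 ^+ N * E `^ p * (E / L) `^ (- (s * p)).

(** [C] is chosen before g, F, R0, L and E: the callers first fix e from the energy, and only then
    make the perturbation small relative to [C]. *)
Lemma gagliardo_perturb (e : R) : 0 < e -> exists2 C, 0 <= C &
  forall (g F : 'rV[R]_N -> R) (R0 L E : R), continuous g -> continuous F ->
    0 <= R0 -> 0 < L -> 0 < E ->
    (forall x y, `|g x - g y| <= `|F x - F y| +
      ((`|x| <= R0) || (`|y| <= R0))%:R * Num.min (L * `|x - y|) E) ->
    (gag g <= (1 + e)%:E * gag F + (C * perturbation_size R0 L E)%:E)%E.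
Proof.
move=> e0; have [C C0 hC] := powR_add_le p1 e0.
exists (C * ((2 * 8 ^+ N * 2 `^ (N%:R + s * p)) / (1 - 2^-1 `^ (p - s * p)) +
    (2 * 16 ^+ N) / (1 - 2 `^ (- (s * p))))); last first.
  move=> g F R0 L E cg cF R00 L0 E0 gF.
  rewrite !gagliardoE.
  apply: (@le_trans _ _ (int_RN_RN (fun x y =>
      (1 + e)%:E * (gagliardo_kernel F x y)%:E + C%:E * (truncated_kernel s p R0 L E x y)%:E)%E)).
    apply: int_pair_le.
    - by move=> x y; rewrite lee_fin gagliardo_kernel_ge0.
    - move=> x y; rewrite -!EFinM -EFinD lee_fin /gagliardo_kernel /truncated_kernel.
      rewrite !mulrA -mulrDl ler_wpM2r ?invr_ge0 ?powR_ge0//.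
      have min0 : 0 <= Num.min (L * `|x - y|) E.
        by rewrite le_min (ltW E0) mulr_ge0// ltW.
      apply: (@le_trans _ _ ((`|F x - F y| +
          ((`|x| <= R0) || (`|y| <= R0))%:R * Num.min (L * `|x - y|) E) `^ p)).
        by apply: ge0_ler_powR; rewrite ?nnegrE ?(ltW p0) ?addr_ge0 ?mulr_ge0.
      apply: le_trans (hC _ _ (normr_ge0 _) _) _; first by rewrite mulr_ge0.
      rewrite lerD2l -mulrA ler_wpM2l//.
      by case: (_ || _); rewrite ?mul1r// !mul0r powR0 ?gt_eqF.
    - exact: pmeas_gagliardo_kernel.
    - by apply: pmeasD; apply: pmeasZ; [exact: pmeas_gagliardo_kernel|exact: pmeas_truncated_kernel].
  have k0 x y : (0 <= (gagliardo_kernel F x y)%:E)%E by rewrite lee_fin gagliardo_kernel_ge0.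
  have t0 x y : (0 <= (truncated_kernel s p R0 L E x y)%:E)%E by rewrite lee_fin truncated_kernel_ge0.
  have mk := pmeas_gagliardo_kernel cF.
  have mt := @pmeas_truncated_kernel R N s p R0 L E.
  have e1 : 0 <= 1 + e by rewrite addr_ge0// ltW.
  rewrite int_pairD//; first last.
  - exact: pmeasZ.
  - exact: pmeasZ.
  - by move=> x y; rewrite mule_ge0 ?lee_fin ?truncated_kernel_ge0.
  - by move=> x y; rewrite mule_ge0 ?lee_fin ?gagliardo_kernel_ge0.
  rewrite !int_pairZ// leeD2l//.
  have := int_truncated_kernel_le (N := N) s0 s1 p0 L0 E0 R00.
  have CE : (0 <= C%:E)%E by rewrite lee_fin.
  move=> J; apply: le_trans (lee_wpmul2l CE J) _.
  by rewrite -EFinM lee_fin /perturbation_size !mulrA.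
rewrite mulr_ge0// addr_ge0// divr_ge0 ?mulr_ge0 ?powR_ge0 ?exprn_ge0//.
  rewrite subr_ge0 -[leRHS](_ : 1 `^ (p - s * p) = 1); last by rewrite powR1.
  apply: ge0_ler_powR; rewrite ?nnegrE ?invr_ge0 ?invf_le1 ?ler1n//.
  by rewrite subr_ge0 ger_pMl// ltW.
rewrite subr_ge0 powRN invf_le1 ?powR_gt0//.
rewrite -[leLHS](_ : 1 `^ (s * p) = 1); last by rewrite powR1.
by apply: ge0_ler_powR; rewrite ?nnegrE ?ler1n// mulr_ge0 ?ltW.
Qed.

End gagliardo_functional.

Definition unif_cont {R : realType} {N : nat} (f : 'rV[R]_N -> R) : Prop :=
  forall e : R, 0 < e -> exists2 d, 0 < d &
    forall x y, `|x - y| <= d -> `|f x - f y| <= e.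

(** * Approximation by smooth compactly supported functions with almost no gain of energy *)

Section approximation.
Context {R : realType} {N : nat} (s p : R).
Hypotheses (s0 : 0 < s) (s1 : s < 1) (p1 : 1 < p) (hsp : N%:R < s * p).

Let p0 : 0 < p. Proof. exact: lt_trans p1. Qed.
Let sp_lt_p : s * p < p. Proof. by rewrite gtr_pMl. Qed.
Local Notation gag := (@gagliardo_p R N s p).

Lemma unif_cont_continuous (f : 'rV[R]_N -> R) : unif_cont f -> continuous f.
Proof.
move=> fu x A /nbhs_ballP[e /= e0 eA].
have [d d0 hd] := fu _ (divr_gt0 e0 (ltr0n _ 2)).
apply/nbhs_ballP; exists d => // y; rewrite -ball_normE /= => xy.
apply: eA; rewrite -ball_normE /=.
by rewrite (le_lt_trans (hd _ _ (ltW xy)))// ltr_pdivrMr// ltr_pMr// ltr1n.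
Qed.

Lemma powR_small (a e : R) : 0 < a -> 0 < e ->
  exists2 x0, 0 < x0 & forall x, 0 <= x -> x <= x0 -> x `^ a <= e.
Proof.
move=> a0 e0; exists (e `^ a^-1); first exact: powR_gt0.
move=> x x0 xe; apply: (@le_trans _ _ ((e `^ a^-1) `^ a)).
  by apply: (ge0_ler_powR (ltW a0)); rewrite ?nnegrE ?powR_ge0.
by rewrite -powRrM mulVf ?gt_eqF// powRr1// ltW.
Qed.

Lemma perturbation_size_cutoff (M e : R) : 0 < M -> 0 < e ->
  exists2 rho0, 0 < rho0 & forall rho, rho0 <= rho ->
    perturbation_size (N := N) s p rho (M / rho) M <= e.
Proof.
move=> M0 e0.
have Mp : 0 < M `^ p by exact: powR_gt0.
have a0 : 0 < s * p - N%:R by rewrite subr_gt0.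
have [x0 x00 hx] := powR_small a0 (divr_gt0 e0 Mp).
exists x0^-1; first by rewrite invr_gt0.
move=> rho xr; have rho0 : 0 < rho by apply: lt_le_trans xr; rewrite invr_gt0.
rewrite /perturbation_size (_ : M / (M / rho) = rho); last first.
  by field; rewrite (gt_eqF M0) (gt_eqF rho0).
have : rho^-1 `^ (s * p - N%:R) <= e / M `^ p.
  by apply: hx; rewrite ?invr_ge0 ?(ltW rho0)// invf_ple ?posrE.
rewrite -(powR_inv1 (ltW rho0)) -powRrM mulN1r opprB powRD; last first.
  by rewrite (gt_eqF rho0) implybT.
by rewrite powR_mulrn ?(ltW rho0)// ler_pdivlMr// mulrAC.
Qed.

Lemma perturbation_size_mollify (R0 L e : R) : 0 <= R0 -> 0 < L -> 0 < e ->
  exists2 E0, 0 < E0 & forall E, 0 < E -> E <= E0 ->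
    perturbation_size (N := N) s p R0 L E <= e.
Proof.
move=> R00 L0 e0.
have a0 : 0 < p - s * p by rewrite subr_gt0.
pose K := R0 ^+ N * L `^ (s * p).
have K0 : 0 <= K by rewrite mulr_ge0 ?exprn_ge0 ?powR_ge0.
have [E0 E00 hE] := powR_small a0 (divr_gt0 e0 (ltr_wpDl K0 ltr01)).
exists E0 => // E Ep EE0.
have -> : perturbation_size (N := N) s p R0 L E = K * E `^ (p - s * p).
  rewrite /perturbation_size powRM ?invr_ge0 ?(ltW L0) ?(ltW Ep)//.
  rewrite -(powR_inv1 (ltW L0)) -powRrM mulN1r opprK.
  rewrite [in RHS]powRD; last by rewrite (gt_eqF Ep) implybT.
  by rewrite /K; ring.
apply: (@le_trans _ _ (K * (e / (K + 1)))); first by rewrite ler_wpM2l// hE// ltW.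
by rewrite mulrA ler_pdivrMr ?ltr_wpDl// mulrC ler_wpM2l ?(ltW e0)// lerDl.
Qed.

Lemma gagliardo_finite (u : 'rV[R]_N -> R) (c : R) : (gag u <= c%:E)%E ->
  exists2 c', gag u = c'%:E & 0 <= c' <= c.
Proof.
have := gagliardo_ge0 s p u; case: (gag u) => [c' | |] //; rewrite ?leye_eq//.
by rewrite !lee_fin => c0 c1; exists c' => //; apply/andP.
Qed.

Lemma cutoff_approx (v : 'rV[R]_N -> R) (M c e : R) (x0 y0 : 'rV[R]_N) :
  unif_cont v -> 0 < M -> (forall x, `|v x| <= M) -> gag v = c%:E -> 0 < e ->
  exists (f : 'rV[R]_N -> R) (rho : R),
    [/\ 0 < rho, unif_cont f, (forall x, `|f x| <= M), (forall x, rho < `|x| -> f x = 0) &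
    [/\ `|f x0 - v x0| <= e, `|f y0 - v y0| <= e & (gag f <= (c + e)%:E)%E]].
Proof.
move=> vu M0 vM vc e0.
have c0 : 0 <= c by rewrite -lee_fin -vc gagliardo_ge0.
have e10 : 0 < e / (2 * (c + 1)) by rewrite divr_gt0// mulr_gt0// ltr_wpDl.
set e1 := e / _ in e10.
have [C C0 hC] := @gagliardo_perturb R N s p s0 s1 p1 _ e10.
have e20 : 0 < e / (2 * (C + 1)) by rewrite divr_gt0// mulr_gt0// ltr_wpDl.
have [rho0 rho00 hrho] := perturbation_size_cutoff M0 e20.
(* The second term gives M |z| / rho <= e for z = x0 and z = y0, which bounds the loss of value at
   these points. *)
pose rho := rho0 + M * (`|x0| + `|y0|) / e.
have B0 : 0 <= M * (`|x0| + `|y0|) / e.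
  by rewrite divr_ge0 ?(ltW e0)// mulr_ge0 ?(ltW M0)// addr_ge0.
have rr : rho0 <= rho by rewrite lerDl.
have r0 : 0 < rho by exact: lt_le_trans rr.
pose eta x : R := Num.max 0 (1 - `|x : 'rV[R]_N| / rho).
have eta01 x : 0 <= eta x <= 1.
  by rewrite le_max lexx /= ge_max ler01 gerBl divr_ge0// ltW.
have eta_out x : rho < `|x| -> eta x = 0.
  by move=> rx; apply/max_idPl; rewrite subr_le0 ler_pdivlMr// mul1r ltW.
have eta_lip x y : `|eta x - eta y| <= `|x - y| / rho.
  wlog xy : x y / eta y <= eta x.
    move=> h; have [xy|/ltW xy] := leP (eta y) (eta x); first exact: h.
    by rewrite distrC (distrC x); exact: h.
  rewrite ger0_norm ?subr_ge0// lerBlDr {1}/eta ge_max; apply/andP; split.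
    by rewrite addr_ge0 ?divr_ge0 ?(ltW r0)//; have /andP[] := eta01 y.
  apply: (@le_trans _ _ (`|x - y| / rho + (1 - `|y| / rho))); last first.
    by rewrite lerD2l /eta le_max lexx orbT.
  have : `|y| / rho <= `|x - y| / rho + `|x| / rho.
    rewrite -mulrDl ler_pM2r ?invr_gt0// (distrC x).
    by rewrite -{1}(subrK x y) ler_normD.
  by lra.
have eta_dist1 x y : `|eta x - eta y| <= 1.
  by have /andP[a1 a2] := eta01 x; have /andP[b1 b2] := eta01 y; rewrite ler_norml; lra.
pose f x := v x * eta x.
have fdist x y : `|f x - f y| <= `|v x - v y| + M * `|eta x - eta y|.
  have -> : f x - f y = (v x - v y) * eta x + v y * (eta x - eta y) by rewrite /f; ring.
  rewrite (le_trans (ler_normD _ _))// !normrM lerD ?ler_wpM2r//.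
  by have /andP[a1 a2] := eta01 x; rewrite ler_piMr// ger0_norm.
have fu : unif_cont f.
  move=> d d0.
  have [d1 d10 hd1] := vu (d / 2) (divr_gt0 d0 (ltr0n _ 2)).
  exists (Num.min d1 (rho * d / (2 * M))).
    by rewrite lt_min d10 divr_gt0 ?mulr_gt0.
  move=> x y; rewrite le_min => /andP[xy1 xy2].
  apply: le_trans (fdist x y) _; rewrite (splitr d) lerD ?hd1//.
  apply: (@le_trans _ _ (M * (`|x - y| / rho))); first by rewrite ler_pM2l.
  rewrite mulrA ler_pdivrMr//; move: xy2; rewrite ler_pdivlMr ?mulr_gt0//.
  by move: `|x - y| => D; lra.
have near z : `|z| <= `|x0| + `|y0| -> `|f z - v z| <= e.
  move=> zz.
  have -> : f z - v z = v z * (eta z - 1) by rewrite /f; ring.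
  rewrite normrM; have /andP[a1 a2] := eta01 z.
  have -> : `|eta z - 1| = 1 - eta z by rewrite ler0_norm ?opprB// subr_le0.
  have h : 1 - eta z <= `|z| / rho.
    by rewrite lerBlDr -lerBlDl /eta le_max lexx orbT.
  apply: (@le_trans _ _ (M * (`|z| / rho))).
    by rewrite ler_pM// subr_ge0.
  rewrite mulrA ler_pdivrMr// -ler_pdivrMl// mulrC.
  apply: (@le_trans _ _ (M * (`|x0| + `|y0|) / e)); last by rewrite lerDr ltW.
  by rewrite ler_wpM2r ?invr_ge0 ?(ltW e0)// ler_wpM2l// ltW.
exists f, rho; split => //.
- move=> x; rewrite normrM; have /andP[a1 a2] := eta01 x.
  by apply: le_trans (vM x); rewrite ler_piMr// ger0_norm.
- by move=> x /eta_out; rewrite /f => ->; rewrite mulr0.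
split; [by apply: near; rewrite lerDl|by apply: near; rewrite lerDr|].
(* The increment changes by at most M |eta x - eta y|, where [eta] is 1/rho-Lipschitz with values in
   [0, 1] and vanishes outside the ball. *)
have cond x y : `|f x - f y| <= `|v x - v y| +
    ((`|x| <= rho) || (`|y| <= rho))%:R * Num.min (M / rho * `|x - y|) M.
  have [_|] := boolP ((`|x| <= rho) || (`|y| <= rho)); last first.
    rewrite negb_or -!ltNge => /andP[/eta_out ex /eta_out ey].
    by rewrite /f ex ey !mulr0 subrr normr0 mul0r addr0.
  rewrite mul1r; apply: le_trans (fdist x y) _; rewrite lerD2l le_min; apply/andP; split.
    by rewrite mulrAC -mulrA ler_pM2l.
  by rewrite ler_piMr// ltW.
have := hC f v rho (M / rho) M (unif_cont_continuous fu) (unif_cont_continuous vu)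
  (ltW r0) (divr_gt0 M0 r0) M0 cond.
move=> /le_trans; apply; rewrite vc -EFinM -EFinD lee_fin.
have h1 : e1 * c <= e / 2.
  rewrite /e1 mulrAC ler_pdivrMr ?mulr_gt0 ?ltr_wpDl//.
  by rewrite (_ : e / 2 * (2 * (c + 1)) = e * c + e); [rewrite lerDl ltW|field].
have h2 : C * perturbation_size (N := N) s p rho (M / rho) M <= e / 2.
  apply: (@le_trans _ _ (C * (e / (2 * (C + 1))))); first by rewrite ler_wpM2l// hrho.
  rewrite mulrA ler_pdivrMr ?mulr_gt0 ?ltr_wpDl//.
  by rewrite (_ : e / 2 * (2 * (C + 1)) = C * e + e); [rewrite lerDl ltW|field].
by rewrite mulrDl mul1r; move: h1 h2; lra.
Qed.

Lemma smooth_approx (v : 'rV[R]_N -> R) (M c e : R) (x0 y0 : 'rV[R]_N) :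
  unif_cont v -> 0 < M -> (forall x, `|v x| <= M) -> gag v = c%:E -> 0 < e ->
  exists (g : 'rV[R]_N -> R) (L rho : R),
    [/\ flat_algebra g, (forall x y, `|g x - g y| <= L * `|x - y|),
        0 < L /\ 0 < rho, (forall x, rho < `|x| -> g x = 0) &
    [/\ `|g x0 - v x0| <= e, `|g y0 - v y0| <= e & (gag g <= (c + e)%:E)%E]].
Proof.
move=> vu M0 vM vc e0.
have e20 : 0 < e / 2 by exact: divr_gt0.
have e40 : 0 < e / 4 by exact: divr_gt0.
have [f [rf [rf0 fu fM fout [fx fy fgag]]]] := cutoff_approx x0 y0 vu M0 vM vc e20.
have [cf fcf /andP[cf0 cfle]] := gagliardo_finite fgag.
(* [r] is the radius of the bump: averaging over shifts of size at most r moves the values of f by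
   at most e / 4. *)
have [r r0 hr] := fu _ e40.
pose Q := (Num.truncn (rf / r)).+1.
have rQ : rf <= r * Q%:R.
  by rewrite mulrC -ler_pdivrMr// ltW// truncnS_gt.
have fout' x : r * Q%:R < `|x| -> f x = 0 by move=> h; apply: fout; exact: le_lt_trans h.
have [L L0 hL] := discrete_mollification r0 fM fout' fu.
pose rho := r * Q.+1%:R.
have rho0 : 0 < rho by rewrite mulr_gt0.
have e10 : 0 < e / (4 * (cf + 1)) by rewrite divr_gt0// mulr_gt0// ltr_wpDl.
set e1 := e / _ in e10.
have [C C0 hC] := @gagliardo_perturb R N s p s0 s1 p1 _ e10.
have e30 : 0 < e / (4 * (C + 1)) by rewrite divr_gt0// mulr_gt0// ltr_wpDl.
have [E0 E00 hE] := perturbation_size_mollify (ltW rho0) L0 e30.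
(* An increment of g - F involves two points, hence 2 eps <= E0; the bound e / 4 is for the values
   at x0 and y0. *)
pose eps := Num.min (E0 / 2) (e / 4).
have eps0 : 0 < eps by rewrite lt_min divr_gt0.
have epsE : 2 * eps <= E0 by rewrite mulrC -ler_pdivlMr// ge_min lexx.
have epse : eps <= e / 4 by rewrite ge_min lexx orbT.
have [sq [w [t [g [w0 w1 wt [ga gL gout gF]]]]]] := hL _ eps0.
set F := fun x : 'rV[R]_N => \sum_(k <- sq) w k * f (x - t k).
have Favg (b : 'rV[int]_N -> R) (d : R) x : 0 <= d ->
    (forall k, w k != 0 -> `|f (x - t k) - b k| <= d) ->
    `|F x - \sum_(k <- sq) w k * b k| <= d.
  move=> d0 hb; rewrite -sumrB (le_trans (ler_norm_sum _ _ _))//.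
  rewrite -[leRHS]mul1r -w1 mulr_suml; apply: ler_sum => k _.
  rewrite -mulrBr normrM (ger0_norm (w0 k)).
  by have [->|wk] := eqVneq (w k) 0; [rewrite !mul0r|rewrite ler_wpM2l// hb].
have Fu : unif_cont F.
  move=> d d0; have [d1 d10 hd1] := fu _ d0; exists d1 => // x y xy.
  apply: Favg (ltW d0) _ => k _; apply: hd1.
  by rewrite opprB addrA subrK.
have Ff x : `|F x - f x| <= e / 4.
  have -> : f x = \sum_(k <- sq) w k * f x by rewrite -mulr_suml w1 mul1r.
  apply: Favg (ltW e40) _ => k /wt tk; apply: hr.
  by rewrite addrC addKr normrN.
have gv z : `|f z - v z| <= e / 2 -> `|g z - v z| <= e.
  move=> fz; have := gF z; have := Ff z; rewrite -/(F z).
  move: fz epse; rewrite !ler_norml => /andP[a1 a2] a3 /andP[a4 a5] /andP[a6 a7].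
  by apply/andP; split; lra.
exists g, L, rho; split => //; split; [exact: gv|exact: gv|].
have cond x y : `|g x - g y| <= `|F x - F y| +
    ((`|x| <= rho) || (`|y| <= rho))%:R * Num.min (L * `|x - y|) (2 * eps).
  have [_|] := boolP ((`|x| <= rho) || (`|y| <= rho)); last first.
    rewrite negb_or -!ltNge => /andP[/gout -> /gout ->].
    by rewrite subrr normr0 mul0r addr0.
  rewrite mul1r -lerBlDl le_min !lerBlDl; apply/andP; split.
    by rewrite (le_trans (gL x y))// lerDr.
  have -> : g x - g y = (F x - F y) + ((g x - F x) - (g y - F y)) by ring.
  rewrite (le_trans (ler_normD _ _))// lerD2l (le_trans (ler_normB _ _))//.
  by rewrite mulr_natl mulr2n; apply: lerD; exact: gF.
have cF := unif_cont_continuous Fu.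
have gagF : (gag F <= gag f)%E.
  exact: (gagliardo_average p1 (unif_cont_continuous fu) w0 w1 cF fcf).
rewrite fcf in gagF; have [cF' FcF /andP[cF0 cFle]] := gagliardo_finite gagF.
have eps20 : 0 < 2 * eps by rewrite mulr_gt0.
have := hC g F rho L (2 * eps) (flat_algebra_continuous ga) cF (ltW rho0) L0 eps20 cond.
move=> /le_trans; apply; rewrite FcF -EFinM -EFinD lee_fin.
have h1 : e1 * cF' <= e / 4.
  apply: (@le_trans _ _ (e1 * cf)); first by rewrite ler_pM2l.
  rewrite /e1 mulrAC ler_pdivrMr ?mulr_gt0 ?ltr_wpDl//.
  by rewrite (_ : e / 4 * (4 * (cf + 1)) = e * cf + e); [rewrite lerDl ltW|field].
have h2 : C * perturbation_size (N := N) s p rho L (2 * eps) <= e / 4.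
  apply: (@le_trans _ _ (C * (e / (4 * (C + 1))))); first by rewrite ler_wpM2l// hE.
  rewrite mulrA ler_pdivrMr ?mulr_gt0 ?ltr_wpDl//.
  by rewrite (_ : e / 4 * (4 * (C + 1)) = C * e + e); [rewrite lerDl ltW|field].
by rewrite mulrDl mul1r; move: h1 h2 cFle cfle; lra.
Qed.

End approximation.

(** * Comparison with the variational constant and strict monotonicity *)

Section normalization.
Context {R : realType} {N : nat}.
Implicit Types (f g : 'rV[R]_N -> R) (x y : 'rV[R]_N).

Lemma holder_ge (a : R) f x y : x != y ->
  ((`|f x - f y| / enorm (x - y) `^ a)%:E <= holder_sn a f)%E.
Proof. by move=> xy; apply: ereal_sup_ubound; exists (x, y). Qed.

Lemma holder_le (a : R) f (C : \bar R) :
  (forall x y, x != y -> ((`|f x - f y| / enorm (x - y) `^ a)%:E <= C)%E) ->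
  (holder_sn a f <= C)%E.
Proof. by move=> h; apply: ge_ereal_sup => _ [[x y] /= xy <-]; exact: h. Qed.

Lemma lipschitz_support_bounded f (L rho : R) : 0 < L -> 0 < rho ->
  (forall x y, `|f x - f y| <= L * `|x - y|) -> (forall x, rho < `|x| -> f x = 0) ->
  forall x, `|f x| <= `|f 0| + L * rho.
Proof.
move=> L0 r0 fL fout x; have [xr|xr] := leP `|x| rho; last first.
  by rewrite fout// normr0 addr_ge0// mulr_ge0 ?ltW.
rewrite -[f x](subrK (f 0)) addrC (le_trans (ler_normD _ _))// lerD2l.
by rewrite (le_trans (fL _ _))// subr0 ler_pM2l.
Qed.

(** Up to distance 1 the Lipschitz bound is used, with d <= d^a; beyond it, the sup bound. This
    makes the seminorm of g finite, so that g can be normalized. *)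
Lemma lipschitz_bounded_holder (a L B : R) f : 0 < a -> a < 1 -> 0 < L ->
  (forall x y, `|f x - f y| <= L * `|x - y|) -> (forall x, `|f x| <= B) ->
  (holder_sn a f <= (L + 2 * B)%:E)%E.
Proof.
move=> a0 a1 L0 fL fB; have B0 : 0 <= B by exact: le_trans (fB 0).
apply: holder_le => x y xy; rewrite lee_fin.
have e0 : 0 < enorm (x - y) by rewrite enorm_gt0// subr_eq0.
rewrite ler_pdivrMr ?powR_gt0//.
have [e1|e1] := leP (enorm (x - y)) 1.
  apply: (@le_trans _ _ (L * enorm (x - y) `^ a)).
    rewrite (le_trans (fL x y))// ler_pM2l// (le_trans (norm_le_enorm _))//.
    by apply: ger1_powR; rewrite ?e0 ?e1// ltW.
  by rewrite ler_wpM2r ?powR_ge0// lerDl mulr_ge0.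
apply: (@le_trans _ _ (2 * B)).
  by rewrite (le_trans (ler_normB _ _))// mulr_natl mulr2n lerD.
rewrite -[leLHS]mulr1; apply: ler_pM => //; first by rewrite mulr_ge0.
  by rewrite lerDr ltW.
rewrite -[leLHS](_ : 1 `^ a = 1); last by rewrite powR1.
by apply: (ge0_ler_powR (ltW a0)); rewrite ?nnegrE ?enorm_ge0 ?ltW.
Qed.

Lemma compact_support f (rho : R) : (forall x, rho < `|x| -> f x = 0) ->
  compact (closure [set x | f x != 0]).
Proof.
move=> fout.
have sub : closure [set x | f x != 0] `<=` [set x : 'rV[R]_N | `|x| <= rho].
  have cl : closed [set x : 'rV[R]_N | `|x| <= rho].
    apply: (@closed_comp _ _ (Num.norm : 'rV[R]_N -> R) [set r : R | r <= rho]).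
      by move=> x _; exact: norm_continuous.
    exact: closed_le.
  rewrite [X in _ `<=` X]((closure_id _).1 cl); apply: closure_subset => x /= fx.
  by rewrite leNgt; apply: contra_neqN fx; exact: fout.
apply: bounded_closed_compact; last exact: closed_closure.
exists rho; split; first exact: num_real.
by move=> b rb x /sub /= xr; rewrite (le_trans xr)// ltW.
Qed.

(** Dividing g by its Hoelder seminorm H gives a competitor of energy c / H^p, and the quotient at
    (x0, y0) is at most H. *)
Lemma m_sp_le (s p : R) g (L rho c : R) x0 y0 : 0 < p ->
  0 < alpha_sp N s p -> alpha_sp N s p < 1 -> 0 < L -> 0 < rho ->
  flat_algebra g -> (forall x y, `|g x - g y| <= L * `|x - y|) ->
  (forall x, rho < `|x| -> g x = 0) -> gagliardo_p N s p g = c%:E -> x0 != y0 ->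
  (m_sp N s p * ((`|g x0 - g y0| / enorm (x0 - y0) `^ alpha_sp N s p) `^ p)%:E <= c%:E)%E.
Proof.
move=> p0 a0 a1 L0 r0 ga gL gout gc xy.
set a := alpha_sp N s p; set t := `|g x0 - g y0| / _.
have c0 : 0 <= c by rewrite -lee_fin -gc gagliardo_ge0.
have [g0|gne] := eqVneq (g x0) (g y0).
  (* The product of an extended real with 0 is 0, whatever the value of [m_sp]. *)
  by rewrite /t g0 subrr normr0 mul0r powR0 ?gt_eqF// mule0 lee_fin.
have t0 : 0 < t.
  by rewrite divr_gt0 ?normr_gt0 ?subr_eq0// powR_gt0// enorm_gt0// subr_eq0.
have tH := holder_ge a g xy; rewrite -/t in tH.
have := lipschitz_bounded_holder a0 a1 L0 gL (lipschitz_support_bounded L0 r0 gL gout).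
rewrite -/a; case HE : (holder_sn a g) tH => [H| |] tH;
  [|by rewrite leye_eq|by rewrite leeNy_eq in tH].
move=> _; rewrite lee_fin in tH; have H0 : 0 < H by exact: lt_le_trans tH.
pose phi x := H^-1 * g x.
have phiq x y : `|phi x - phi y| / enorm (x - y) `^ a =
    H^-1 * (`|g x - g y| / enorm (x - y) `^ a).
  by rewrite /phi -mulrBr normrM gtr0_norm ?invr_gt0// mulrA.
have phi_holder : holder_sn a phi = 1%E.
  apply/eqP; rewrite eq_le; apply/andP; split.
    apply: holder_le => x y xy'; rewrite phiq lee_fin mulrC ler_pdivrMr// mul1r.
    by rewrite -lee_fin -HE; exact: holder_ge.
  have : (0%:E <= holder_sn a phi)%E.
    by apply: le_trans (holder_ge a phi xy); rewrite lee_fin divr_ge0 ?powR_ge0.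
  case hE : (holder_sn a phi) => [h| |] // h0; last by rewrite leey.
  rewrite lee_fin -(ler_pM2l H0) mulr1 -lee_fin -HE.
  apply: holder_le => x y xy'.
  have := holder_ge a phi xy'; rewrite hE phiq !lee_fin.
  by rewrite -(ler_pM2l H0) mulrA divff ?gt_eqF// mul1r.
have phi_gag : gagliardo_p N s p phi = (H^-1 `^ p * c)%:E.
  have -> : gagliardo_p N s p phi = int_RN_RN (fun x y =>
      (H^-1 `^ p)%:E * (gagliardo_kernel s p g x y)%:E)%E.
    apply: eq_int_pair => x y; rewrite -EFinM /gagliardo_kernel /phi -mulrBr normrM.
    by rewrite powRM// (gtr0_norm (_ : 0 < H^-1)) ?invr_gt0// mulrA.
  have kg0 x y : (0 <= (gagliardo_kernel s p g x y)%:E)%E.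
    by rewrite lee_fin gagliardo_kernel_ge0.
  have mg := pmeas_gagliardo_kernel s p (flat_algebra_continuous ga).
  rewrite (int_pairZ (powR_ge0 _ _) kg0 mg) EFinM -gc.
  by congr (_ * _)%E.
have mphi : (m_sp N s p <= (H^-1 `^ p * c)%:E)%E.
  rewrite -phi_gag; apply: ereal_inf_lbound; exists phi => //; split => //; split.
    by apply: flat_algebra_smooth; apply: flat_algebraM => //; exact: flat_algebra_cst.
  by apply: (compact_support (rho := rho)) => x /gout; rewrite /phi => ->; rewrite mulr0.
have tp0 : (0 <= (t `^ p)%:E)%E by rewrite lee_fin powR_ge0.
apply: le_trans (lee_wpmul2r tp0 mphi) _.
rewrite -EFinM lee_fin mulrAC -powRM ?invr_ge0 ?(ltW H0) ?(ltW t0)//.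
rewrite -[leRHS]mul1r ler_wpM2r// -[leRHS](_ : 1 `^ p = 1); last by rewrite powR1.
apply: (ge0_ler_powR (ltW p0)).
- by rewrite nnegrE mulr_ge0 ?invr_ge0 ?(ltW H0) ?(ltW t0).
- by rewrite nnegrE.
by rewrite mulrC ler_pdivrMr// mul1r.
Qed.

End normalization.

(** * Strict decrease of the energy *)

Section strict_monotonicity.
Context {R : realType} {N : nat} (s p : R).
Hypotheses (s0 : 0 < s) (p1 : 1 < p).

Let p0 : 0 < p. Proof. exact: lt_trans p1. Qed.

Lemma continuous_ball (f : 'rV[R]_N -> R) (a : 'rV[R]_N) (e : R) :
  continuous f -> 0 < e ->
  exists2 d, 0 < d & forall x, `|a - x| <= d -> `|f a - f x| <= e.
Proof.
move=> cf e0; have /cvgrPdist_le /(_ _ e0) /nbhs_ballP[d /= d0 hd] := cf a.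
exists (d / 2); first exact: divr_gt0.
move=> x xd; apply: hd; rewrite -ball_normE /=.
by rewrite (le_lt_trans xd)// ltr_pdivrMr// ltr_pMr// ltr1n.
Qed.

(** By continuity the strict inequality at (a, b) persists, with a gap, on a product of two cubes,
    where the kernels differ by at least [k]. The energies then differ by [k] times the volume, a
    strict gap since that of v is finite. *)
Lemma gagliardo_lt (u v : 'rV[R]_N -> R) (a b : 'rV[R]_N) (c : R) :
  continuous u -> continuous v ->
  (forall x y, `|v x - v y| <= `|u x - u y|) -> `|v a - v b| < `|u a - u b| ->
  gagliardo_p N s p u = c%:E -> (gagliardo_p N s p v < gagliardo_p N s p u)%E.
Proof.
move=> cu cv vu ab uc.
set U := `|u a - u b| in ab; set V := `|v a - v b| in ab.
(* Each increment moves by at most 2 e near (a, b), and V + 2 e < U - 2 e. *)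
pose e : R := (U - V) / 5.
have e0 : 0 < e by rewrite divr_gt0// subr_gt0.
have [d1 d10 h1] := continuous_ball a cu e0.
have [d2 d20 h2] := continuous_ball b cu e0.
have [d3 d30 h3] := continuous_ball a cv e0.
have [d4 d40 h4] := continuous_ball b cv e0.
pose d : R := Num.min (Num.min d1 d2) (Num.min d3 d4).
have d0 : 0 < d by rewrite !lt_min d10 d20 d30 d40.
pose A1 : R := V + 2 * e; pose A2 : R := U - 2 * e.
have V0 : 0 <= V by exact: normr_ge0.
have A10 : 0 <= A1 by rewrite /A1; move: V0 e0; lra.
have A12 : A1 < A2 by rewrite /A1 /A2; move: e0; rewrite /e; lra.
pose q := N%:R + s * p.
have q0 : 0 < q by rewrite ltr_wpDl// mulr_gt0.
(* An upper bound for the Euclidean distance of pairs in the two cubes. *)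
pose W : R := N%:R * (`|a - b| + 2 * d).
have W0 : 0 <= W.
  by apply: mulr_ge0; rewrite ?ler0n//; have := normr_ge0 (a - b); move: d0; lra.
pose k := (A2 `^ p - A1 `^ p) / (W `^ q + 1).
have W1 : 0 < W `^ q + 1 by rewrite ltr_wpDl ?powR_ge0.
have A12p : A1 `^ p < A2 `^ p.
  by apply: (gt0_ltr_powR p0); rewrite ?nnegrE// (le_trans A10)// ltW.
have k0 : 0 < k by rewrite divr_gt0// subr_gt0.
(* After the shift by a, this is the product of the cubes of radius d about a and b. *)
pose box (x y : 'rV[R]_N) : \bar R := ((`|x| <= d) && (`|0 *: x + (b - a) - y| <= d))%R%:R%:E.
have mbox : pmeas box by exact: pmeas_ball_ball.
have box0 x y : (0 <= box x y)%E by rewrite lee_fin.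
have kbox0 (x y : 'rV[R]_N) : (0 <= k%:E * box (x - a)%R (y - a)%R)%E by rewrite mule_ge0// lee_fin ltW.
have mkbox : pmeas (fun x y : 'rV[R]_N => k%:E * box (x - a)%R (y - a)%R)%E.
  by apply: pmeasZ; exact: pmeas_translate.
have K0 f x y : (0 <= (gagliardo_kernel s p f x y)%:E)%E by rewrite lee_fin gagliardo_kernel_ge0.
have : (gagliardo_p N s p v + (k * ((d *+ 2) ^+ N * (d *+ 2) ^+ N))%:E <= gagliardo_p N s p u)%E.
  rewrite EFinM -(int_ball_ball 0 (b - a) (ltW d0) (ltW d0)) -/box.
  rewrite -(int_pair_translate (- a) box0 mbox).
  rewrite -(int_pairZ (ltW k0)); [|by move=> x y; exact: box0|exact: pmeas_translate].
  rewrite gagliardoE -int_pairD//; last exact: pmeas_gagliardo_kernel.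
  apply: int_pair_le.
  - by move=> x y; rewrite adde_ge0.
  - move=> x y; rewrite /box scale0r add0r opprB addrA subrK.
    have mono : gagliardo_kernel s p v x y <= gagliardo_kernel s p u x y.
      rewrite ler_wpM2r ?invr_ge0 ?powR_ge0//.
      by apply: (ge0_ler_powR (ltW p0)); rewrite ?nnegrE.
    case: andP => [[xa yb]|_]; last by rewrite mulr0n mule0 adde0 lee_fin.
    rewrite mule1 -EFinD lee_fin.
    move: xa yb; rewrite distrC !le_min => /andP[/andP[x1 x2] /andP[x3 x4]].
    move=> /andP[/andP[y1 y2] /andP[y3 y4]].
    have {h1}ux := h1 _ x1; have {h2}uy := h2 _ y2.
    have {h3}vx := h3 _ x3; have {h4}vy := h4 _ y4.
    have Vxy : `|v x - v y| <= A1.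
      have -> : v x - v y = (v a - v b) + ((v b - v y) - (v a - v x)) by ring.
      rewrite (le_trans (ler_normD _ _))// lerD2l (le_trans (ler_normB _ _))//.
      by rewrite mulr_natl mulr2n lerD.
    have Uxy : A2 <= `|u x - u y|.
      rewrite lerBlDr.
      rewrite /U; have -> : u a - u b = (u x - u y) + ((u a - u x) - (u b - u y)) by ring.
      rewrite (le_trans (ler_normD _ _))// lerD2l (le_trans (ler_normB _ _))//.
      by rewrite mulr_natl mulr2n lerD.
    have xny : x != y.
      apply: contraTneq Uxy => ->; rewrite subrr normr0 -ltNge.
      exact: le_lt_trans A12.
    have exy : 0 < enorm (x - y) `^ q by rewrite powR_gt0// enorm_gt0// subr_eq0.
    have eW : enorm (x - y) `^ q <= W `^ q + 1.
      apply: (@le_trans _ _ (W `^ q)); last by rewrite lerDl.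
      apply: (ge0_ler_powR (ltW q0)); rewrite ?nnegrE ?enorm_ge0//.
      rewrite (le_trans (enorm_le_norm _))// ler_wpM2l//.
      have -> : x - y = (a - b) + ((b - y) - (a - x)).
        by apply/rowP => i; rewrite !mxE; ring.
      rewrite (le_trans (ler_normD _ _))// lerD2l (le_trans (ler_normB _ _))//.
      by rewrite mulr_natl mulr2n lerD// !le_min ?x1 ?x2 ?x3 ?x4 ?y1 ?y2 ?y3 ?y4.
    have Up : A2 `^ p <= `|u x - u y| `^ p.
      by apply: (ge0_ler_powR (ltW p0)); rewrite ?nnegrE// (le_trans A10)// ltW.
    have Vp : `|v x - v y| `^ p <= A1 `^ p.
      by apply: (ge0_ler_powR (ltW p0)); rewrite ?nnegrE.
    rewrite -lerBrDl /gagliardo_kernel -mulrBl -/q /k.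
    apply: ler_pM.
    + by rewrite subr_ge0 ltW.
    + by rewrite invr_ge0 ltW.
    + exact: lerB.
    + by rewrite lef_pV2.
  - by apply: pmeasD => //; exact: pmeas_gagliardo_kernel.
  - exact: pmeas_gagliardo_kernel.
rewrite uc => h; apply: lt_le_trans h.
have vol : 0 < k * ((d *+ 2) ^+ N * (d *+ 2) ^+ N).
  by rewrite mulr_gt0// mulr_gt0// exprn_gt0// mulrn_wgt0.
have vle : (gagliardo_p N s p v <= c%:E)%E.
  rewrite -uc !gagliardoE; apply: int_pair_le => //; try exact: pmeas_gagliardo_kernel.
  move=> x y; rewrite lee_fin ler_wpM2r ?invr_ge0 ?powR_ge0//.
  by apply: (ge0_ler_powR (ltW p0)); rewrite ?nnegrE.
have [c' -> _] := gagliardo_finite vle.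
by rewrite -EFinD lte_fin ltrDl.
Qed.

End strict_monotonicity.

(** * Truncation of the extremal and conclusion *)

Lemma clamp_lipschitz {R : realType} (m M a b : R) : m <= M ->
  `|Num.max m (Num.min M a) - Num.max m (Num.min M b)| <= `|a - b|.
Proof.
wlog ab : a b / b <= a.
  move=> h mM; have [ab|/ltW ab] := leP b a; first exact: h.
  by rewrite distrC (distrC a); exact: h.
move=> mM; rewrite (ger0_norm (_ : 0 <= a - b)) ?subr_ge0// ger0_norm.
  by case: (leP M a) => ?; case: (leP M b) => ?; case: (leP m M) => ?;
    case: (leP m a) => ?; case: (leP m b) => ?; lra.
by rewrite subr_ge0 ge_max !le_max lexx /= le_min !ge_min lexx ab !orbT.
Qed.

Lemma holder_unif_cont {R : realType} {N : nat} (a H : R) (u : 'rV[R]_N -> R) :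
  (0 < N)%N -> 0 < a -> 0 <= H ->
  (forall x y, x != y -> `|u x - u y| / enorm (x - y) `^ a <= H) -> unif_cont u.
Proof.
move=> N0 a0 H0 uH e e0.
have [d d0 hd] := powR_small a0 (divr_gt0 e0 (ltr_wpDl H0 ltr01)).
have NR : 0 < N%:R :> R by rewrite ltr0n.
exists (d / N%:R); first exact: divr_gt0.
move=> x y; rewrite ler_pdivlMr// mulrC => xyd.
have [->|xy] := eqVneq x y; first by rewrite subrr normr0 ltW.
have e1 : 0 < enorm (x - y) by rewrite enorm_gt0// subr_eq0.
have := uH _ _ xy; rewrite ler_pdivrMr ?powR_gt0// => /le_trans; apply.
have := hd _ (enorm_ge0 _) (le_trans (enorm_le_norm _) xyd).
rewrite ler_pdivlMr ?ltr_wpDl// mulrC => h; apply: le_trans h.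
by rewrite ler_wpM2r ?powR_ge0// lerDl.
Qed.

Theorem theorem7p7 (R : realType) (N : nat) (s p : R)
  (hN : (1 <= N)%N) (hs0 : 0 < s) (hs1 : s < 1) (hp1 : 1 < p)
  (hsp : N%:R < s * p)
  (u : 'rV[R]_N -> R) (hu : extremal N s p u)
  (x0 y0 : 'rV[R]_N) (hxy : x0 != y0)
  (hmax : holder_sn (alpha_sp N s p) u =
          ((`|u x0 - u y0| / (enorm (x0 - y0) `^ alpha_sp N s p))%:E)) :
  (exists M : R, forall x, `|u x| <= M) /\
  (forall x, Num.min (u x0) (u y0) <= u x <= Num.max (u x0) (u y0)).
Proof.
have p0 : 0 < p by exact: lt_trans hp1.
set a := alpha_sp N s p in hmax.
have a0 : 0 < a by rewrite subr_gt0 ltr_pdivrMr.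
have a1 : a < 1.
  by apply: le_lt_trans hs1; rewrite gerBl divr_ge0// ltW.
have [[cu [_ ufin]] [[xn [yn uxy]] uext]] := hu.
have [c uc /andP[c0 _]] : exists2 c, gagliardo_p N s p u = c%:E & 0 <= c <= c.
  move: ufin (gagliardo_ge0 s p u); case: (gagliardo_p N s p u) => [c| |]//= _.
  by rewrite lee_fin => c0; exists c => //; rewrite c0 lexx.
set D := `|u x0 - u y0| in hmax; set E := enorm (x0 - y0) `^ a in hmax.
have E0 : 0 < E by rewrite powR_gt0// enorm_gt0// subr_eq0.
set H := D / E in hmax.
have uH x y : x != y -> `|u x - u y| / enorm (x - y) `^ a <= H.
  by move=> xy; have := holder_ge a u xy; rewrite hmax lee_fin.
have xyn : xn != yn by apply: contra_neq uxy => ->.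
(* Non-constancy of u forces H > 0, hence u x0 and u y0 differ. *)
have H0 : 0 < H.
  apply: lt_le_trans (uH _ _ xyn); apply: divr_gt0.
    by rewrite normr_gt0 subr_eq0.
  by apply/powR_gt0/enorm_gt0; rewrite subr_eq0.
have D0 : 0 < D by move: H0; rewrite /H pmulr_lgt0 ?invr_gt0.
pose m := Num.min (u x0) (u y0); pose M := Num.max (u x0) (u y0).
have mM : m <= M by rewrite /m /M ge_min !le_max lexx.
pose v x := Num.max m (Num.min M (u x)).
have vu x y : `|v x - v y| <= `|u x - u y| by exact: clamp_lipschitz.
have v_bnd x : m <= v x <= M by rewrite /v le_max lexx /= ge_max mM ge_min lexx.
have v_id x : m <= u x <= M -> v x = u x.
  by move=> /andP[h1 h2]; rewrite /v (min_idPr h2) (max_idPr h1).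
have vx0 : v x0 = u x0 by apply: v_id; rewrite /m /M ge_min le_max lexx.
have vy0 : v y0 = u y0 by apply: v_id; rewrite /m /M ge_min le_max lexx !orbT.
have v_unif : unif_cont v.
  apply: (holder_unif_cont hN a0 (ltW H0)) => x y xy.
  apply: le_trans (uH _ _ xy); rewrite ler_wpM2r ?invr_ge0 ?powR_ge0//.
have cv := unif_cont_continuous v_unif.
suff uv x : u x = v x.
  split; last by move=> x; rewrite (uv x); exact: v_bnd.
  exists (`|m| + `|M|) => x; rewrite (uv x); have /andP[h1 h2] := v_bnd x.
  have := ler_norm M; have := ler_norm (- m); rewrite normrN.
  have := normr_ge0 m; have := normr_ge0 M.
  by rewrite ler_norml; lra.
apply/eqP/negPn/negP => uvx.
(* If u x < m, take for b whichever of x0, y0 has the value M, and symmetrically: truncation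
   strictly shortens the increment towards the opposite extreme. *)
have [b ab] : exists b, `|v x - v b| < `|u x - u b|.
  have mb : exists b, u b = m /\ v b = m.
    by rewrite /m; case: leP => _; [exists x0|exists y0].
  have Mb : exists b, u b = M /\ v b = M.
    by rewrite /M; case: leP => _; [exists y0|exists x0].
  have [ux|ux] := ltP (u x) m.
    have [b [ub vb]] := Mb; exists b; rewrite ub vb.
    have -> : v x = m by rewrite /v; apply/max_idPl; rewrite ge_min (ltW ux) orbT.
    rewrite (ler0_norm (_ : m - M <= 0)) ?subr_le0// (ler0_norm (_ : u x - M <= 0));
      by move: mM ux; lra.
  have [Mu|uM] := ltP M (u x); last by move: uvx; rewrite v_id ?eqxx// ux.
  have [b [ub vb]] := mb; exists b; rewrite ub vb.
  have -> : v x = M by rewrite /v (min_idPl (ltW Mu)) (max_idPr mM).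
  rewrite (ger0_norm (_ : 0 <= M - m)) ?subr_ge0// (ger0_norm (_ : 0 <= u x - m));
    by move: mM Mu; lra.
have := gagliardo_lt hs0 hp1 cu cv vu ab uc.
rewrite uc => vlt.
have [d vd /andP[d0 _]] := gagliardo_finite (ltW vlt).
rewrite vd lte_fin in vlt.
have Hp0 : 0 < H `^ p by exact: powR_gt0.
(* The extremal identity has a finite left side and H^p > 0, which excludes infinite values of
   [m_sp]. *)
have [k mk] : exists k, m_sp N s p = k%:E.
  move: uext; rewrite hmax uc /=; case: (m_sp N s p) => [k| |] //=.
  - by exists k.
  - by rewrite gt0_mulye// lte_fin.
  - by rewrite gt0_mulNye// lte_fin.
have ck : c = k * H `^ p by move: uext; rewrite hmax uc mk /= -EFinM => -[].
(* Smooth approximations g of the truncation v satisfy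
   k (|g x0 - g y0| / E)^p <= d + e, which contradicts d < c = k (D / E)^p. *)
have cpos : 0 < c by exact: le_lt_trans vlt.
(* l c is the midpoint of d and c, and r = l^(1/p) is the fraction of D that g has to retain. Below,
   e is such that two errors of size e cost at most (1 - r) D and that d + e < l c. *)
pose l := (d + c) / 2 / c.
have l0 : 0 < l by rewrite !divr_gt0// ltr_wpDl.
have l1 : l < 1 by rewrite ltr_pdivrMr// mul1r; lra.
pose r := l `^ p^-1.
have r0 : 0 < r by exact: powR_gt0.
have rp : r `^ p = l by rewrite -powRrM mulVf ?gt_eqF// powRr1// ltW.
have r1 : r < 1.
  rewrite ltNge; apply/negP => r1.
  have : 1 `^ p <= r `^ p by apply: (ge0_ler_powR (ltW p0)); rewrite ?nnegrE// ltW.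
  by rewrite powR1 rp leNgt l1.
pose e := Num.min ((1 - r) * D / 2) ((c - d) / 4).
have e0 : 0 < e.
  by rewrite lt_min; apply/andP; split; rewrite divr_gt0// ?mulr_gt0// subr_gt0.
have B0 : 0 < `|m| + `|M| + 1 by rewrite ltr_wpDl// addr_ge0.
have vB x1 : `|v x1| <= `|m| + `|M| + 1.
  have /andP[h1 h2] := v_bnd x1.
  have := ler_norm M; have := ler_norm (- m); rewrite normrN.
  have := normr_ge0 m; have := normr_ge0 M.
  by rewrite ler_norml; lra.
have [g [L [rho [ga gL [L0 rho0] gout [gx gy gle]]]]] :=
  smooth_approx hs0 hs1 hp1 hsp x0 y0 v_unif B0 vB vd e0.
have [cg gcg /andP[_ cgle]] := gagliardo_finite gle.
have := m_sp_le p0 a0 a1 L0 rho0 ga gL gout gcg hxy.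
rewrite -/a -/E mk -EFinM lee_fin.
have gD : r * D <= `|g x0 - g y0|.
  have e1 : e <= (1 - r) * D / 2 by rewrite ge_min lexx.
  have : D <= `|g x0 - g y0| + (e + e).
    have -> : D = `|(g x0 - g y0) + ((g y0 - v y0) - (g x0 - v x0))|.
      by rewrite vx0 vy0 /D; congr `|_|; ring.
    by rewrite (le_trans (ler_normD _ _))// lerD2l (le_trans (ler_normB _ _))// lerD.
  by move: e1; rewrite mulrBl mul1r; lra.
have k0 : 0 < k by move: cpos; rewrite ck pmulr_lgt0.
have h : l * c <= k * (`|g x0 - g y0| / E) `^ p.
  rewrite -rp ck mulrCA ler_pM2l// -powRM ?(ltW r0) ?(ltW H0)//.
  apply: (ge0_ler_powR (ltW p0)).
  - by rewrite nnegrE mulr_ge0// ltW.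
  - by rewrite nnegrE divr_ge0// ltW.
  by rewrite /H mulrA ler_pM2r ?invr_gt0.
move=> /(le_trans h) /le_trans /(_ cgle).
have -> : l * c = (d + c) / 2 by rewrite /l divfK// gt_eqF.
have : e <= (c - d) / 4 by rewrite ge_min lexx orbT.
by move: vlt; lra.
Qed.
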